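(* Fix $\alpha_1\ge1$ and assume that $\lambda=\lambda(N)\in(0,1)$ satisfies $\lambda\gg\frac1N$ as $N\to\infty$. Set $g_N(x,t):=\frac1N X^{\max}_{\lfloor xN\rfloor}(Nt/\lambda)$ for $x\in[0,1]$, $t\ge0$. Then for all $x\in(0,1)$ and $t>0$ such that $x\ne t$, $g_N(x,t)$ converges in probability to $\mathbf 1_{[t,1]}(x)$ as $N\to\infty$.
   Context: Let $\alpha_1\ge1$ (independent of $N$), $N\ge2$, $\lambda=\lambda(N)\in(0,1)$, $r:=\frac{1+\lambda}{1-\lambda}$ and $\alpha_k:=\alpha_1 r^{k-1}$ for $k\in\{1,\dots,N\}$. The state space is $S_N:=\{x\in\mathbb R^{N+1}: 0=x_0\le x_1\le\dots\le x_N=N\}$. For $x\in S_N$, $(X^x(t),t\ge0)$ is the continuous-time Markov process started from $x$ that evolves as follows: each $k\in\{1,\dots,N-1\}$ carries an independent rate $1$ Poisson clock; if the $k$-th clock rings at time $t$, then $X^x_k(t):=(1-\Theta_k)X^x_{k-1}(t-)+\Theta_kX^x_{k+1}(t-)$, where $\Theta_k$ is a fresh independent Beta$(\alpha_k,\alpha_{k+1})$ random variable (the other coordinates do not change). $X^{\max}$ is the process started from the maximal configuration $\max=(0,N,\dots,N)$. The notation $a_N\gg b_N$ means $b_N/a_N\to0$ as $N\to\infty$; $[t,1]=\emptyset$ if $t>1$. *)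

(* Defs.v *)
From HB Require Import structures.
From mathcomp Require Import all_boot all_order all_algebra.
From mathcomp Require Import all_classical all_reals all_analysis.
Set Implicit Arguments.
Unset Strict Implicit.
Unset Printing Implicit Defensive.
Import Order.TTheory GRing.Theory Num.Theory.
Import numFieldNormedType.Exports.
Local Open Scope classical_set_scope.
Local Open Scope ring_scope.

(* Independence of the classes of events [F i], [i] in [D]: the product rule
   for every finite subfamily. *)
Definition mutually_independent (R : realType) (d : measure_display)
    (Om : measurableType d) (P : probability Om R) (I : eqType) (D : set I)
    (F : I -> set (set Om)) : Prop :=
  forall (J : seq I) (E : I -> set Om), uniq J ->
    (forall i, i \in J -> D i /\ F i (E i)) ->
    P (\bigcap_(i in [set` J]) E i) = (\prod_(i <- J) P (E i))%E.

Definition generated_events (R : realType) (d d' : measure_display)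
    (Om : measurableType d) (P : probability Om R) (T : measurableType d')
    (Y : {RV P >-> T}) : set (set Om) :=
  preimage_set_system setT Y measurable.

(* Time is [R]; only the times t >= 0 are ever constrained. *)
Definition process_events (R : realType) (d d' : measure_display)
    (Om : measurableType d) (P : probability Om R) (T : measurableType d')
    (Y : R -> {RV P >-> T}) : set (set Om) :=
  <<s \bigcup_(t in [set t | 0 <= t]) generated_events (Y t) >>.

(* The second argument of the library's [poisson_prob] is a dummy; for rate 0
   [poisson_prob] is the Dirac mass at 0. *)
Record poisson_process (R : realType) (d : measure_display)
    (Om : measurableType d) (P : probability Om R) (rate : R)
    (C : R -> {RV P >-> nat}) : Prop := PoissonProcess {
  poisson_start : forall w, C 0 w = 0%N ;
  poisson_nondecreasing : forall w (s t : R), 0 <= s -> s <= t ->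
    (C s w <= C t w)%N ;
  poisson_right_continuous : forall w (t : R), 0 <= t ->
    \forall s \near t^'+, C s w = C t w ;
  poisson_increment_law : forall (s t : R), 0 <= s -> s <= t ->
    forall U : set nat,
      P [set w | U (C t w - C s w)%N] = poisson_prob (rate * (t - s)) 0 U ;
  poisson_independent_increments : forall t : nat -> R, 0 <= t 0%N ->
    (forall j, t j <= t j.+1) ->
    mutually_independent P setT (fun j : nat =>
      [set A | exists U : set nat,
        A = [set w | U (C (t j.+1) w - C (t j) w)%N]]) }.

(* The clock with counting path [c] rings at time [t]. *)
Definition rings (R : realType) (c : R -> nat) (t : R) : Prop :=
  0 < t /\ forall s, 0 <= s -> s < t -> (c s < c t)%N.

(* Beta laws with real parameters (the library's [beta_prob] only has natural
   ones). *)
Definition beta_weight (R : realType) (a b x : R) : R :=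
  x `^ (a - 1) * (1 - x) `^ (b - 1).

Definition beta_density (R : realType) (a b x : R) : R :=
  if 0 < x < 1 then
    beta_weight a b x /
      \int[lebesgue_measure]_(y in `]0, 1[) beta_weight a b y
  else 0.

Definition has_beta_law (R : realType) (d : measure_display)
    (Om : measurableType d) (P : probability Om R) (a b : R)
    (Y : {RV P >-> R}) : Prop :=
  forall A : set R, measurable A ->
    distribution P Y A =
    (\int[lebesgue_measure]_(x in A) (beta_density a b x)%:E)%E.

Definition alpha (R : realType) (alpha1 lambda : R) (k : nat) : R :=
  alpha1 * ((1 + lambda) / (1 - lambda)) ^+ k.-1.

Definition state_space (R : realType) (N : nat) : set ('I_N.+1 -> R) :=
  [set x | [/\ x ord0 = 0,
               forall i j : 'I_N.+1, (i <= j)%N -> x i <= x j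
             & x ord_max = N%:R]].

Definition max_config (R : realType) (N : nat) (k : 'I_N.+1) : R :=
  if k == ord0 then 0 else N%:R.

Lemma max_config_state_space (R : realType) (N : nat) :
  (0 < N)%N -> state_space (@max_config R N).
Proof.
move=> N0; split; rewrite /max_config ?eqxx//.
- move=> i j ij; case: (eqVneq i ord0) => [_|i0]; first by case: ifP.
  case: eqVneq => // j0; move: i0; rewrite -val_eqE/=.
  by move: ij; rewrite j0 /= leqn0 => ->.
- by rewrite -val_eqE/= gtn_eqF.
Qed.

(* The sites carrying a clock. *)
Definition bulk (N : nat) (k : 'I_N.+1) : Prop := (0 < k < N)%N.

(* Graphical construction: [clock k] counts the rings at site [k], and
   [Theta k n] is the variable used at the n-th ring of that clock (n >= 1). *)
Record driving_noise (R : realType) (d : measure_display)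
    (Om : measurableType d) (P : probability Om R) (N : nat)
    (alpha1 lambda : R) (clock : 'I_N.+1 -> R -> {RV P >-> nat})
    (Theta : 'I_N.+1 -> nat -> {RV P >-> R}) : Prop := DrivingNoise {
  noise_clock : forall k, bulk k -> poisson_process 1 (clock k) ;
  noise_Theta : forall k n, bulk k ->
    has_beta_law (alpha alpha1 lambda k) (alpha alpha1 lambda k.+1)
      (Theta k n) ;
  noise_independent :
    mutually_independent P
      (fun i : 'I_N.+1 + 'I_N.+1 * nat =>
         match i with inl k => bulk k | inr (k, _) => bulk k end)
      (fun i => match i with
                | inl k => process_events (clock k)
                | inr (k, n) => generated_events (Theta k n)
                end) }.

(* [lim (f s @[s --> t^'-])] is f(t-); it exists because [X t k] is constant
   between the rings of clock [k], which are locally finite. *)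
Record resampling_process (R : realType) (d : measure_display)
    (Om : measurableType d) (P : probability Om R) (N : nat)
    (alpha1 lambda : R) (x : 'I_N.+1 -> R)
    (clock : 'I_N.+1 -> R -> {RV P >-> nat})
    (Theta : 'I_N.+1 -> nat -> {RV P >-> R})
    (X : R -> 'I_N.+1 -> {RV P >-> R}) : Prop := ResamplingProcess {
  process_noise : driving_noise alpha1 lambda clock Theta ;
  process_start_state : state_space x ;
  process_start : forall w k, X 0 k w = x k ;
  process_boundary : forall w k t, 0 <= t -> ~ bulk k -> X t k w = X 0 k w ;
  process_still : forall w k s t, bulk k -> 0 <= s -> s <= t ->
    (forall u, s < u -> u <= t -> ~ rings (clock k ^~ w) u) ->
    X t k w = X s k w ;
  process_update : forall w k t, bulk k -> rings (clock k ^~ w) t ->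
    let theta := Theta k (clock k t w) w in
    X t k w = (1 - theta) * lim (X s (inord k.-1) w @[s --> t^'-])
              + theta * lim (X s (inord k.+1) w @[s --> t^'-]) }.

(* a_N >> b_N *)
Definition dominates (R : realType) (a b : nat -> R) : Prop :=
  b N / a N @[N --> \oo] --> (0 : R).

Definition rescaled_profile (R : realType) (d : measure_display)
    (Om : measurableType d) (P : probability Om R) (N : nat) (lambda : R)
    (X : R -> 'I_N.+1 -> {RV P >-> R}) (x t : R) (w : Om) : R :=
  N%:R^-1 * X (N%:R * t / lambda) (inord (Num.truncn (x * N%:R))) w.

(* Convergence in probability to a constant; the probability space may change
   with N. *)
Definition cvg_in_probability (R : realType) (d : nat -> measure_display)
    (Om : forall N, measurableType (d N)) (P : forall N, probability (Om N) R)
    (Y : forall N, Om N -> R) (l : R) : Prop :=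
  forall eps : R, 0 < eps ->
    P N [set w | eps <= `|Y N w - l|] @[N --> \oo] --> 0%E.

(* Main.v *)
Require Import Defs.
From HB Require Import structures.
From mathcomp Require Import all_boot all_order all_algebra.
From mathcomp Require Import all_classical all_reals all_analysis.
From mathcomp Require Import measurable_realfun zify lra ring.
Set Implicit Arguments.
Unset Strict Implicit.
Unset Printing Implicit Defensive.
Import Order.TTheory GRing.Theory Num.Theory.
Import numFieldNormedType.Exports.
Local Open Scope classical_set_scope.
Local Open Scope ring_scope.

(** Only first moments matter.  Each resampling variable has mean
    (1 - lambda) / 2, so u_k(s) = E X_k(s) satisfies
      u_k' = (1 + lambda)/2 u_(k-1) + (1 - lambda)/2 u_(k+1) - u_k
    at the bulk sites: u_k(s) / N is the probability that a walk with drift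
    - lambda, started at k and stopped at 0 and N, has not been absorbed at 0
    by time s.  At time N t / lambda this walk has travelled N t, with
    fluctuations of order sqrt (N t / lambda), which are negligible against N
    because lambda >> 1/N.  Hence u_k / N tends to 0 for k = x N with x < t, and
    to 1 for t < x.  As 0 <= X_k <= N, Markov's inequality for X_k in the first
    case and for N - X_k in the second gives convergence in probability.

    The walk itself is replaced by explicit supersolutions of its equation.
    For x < t the profile N (1 + a lambda)^k exp (- a (1 - a) lambda^2 s)
    dominates u away from site N, and N (1 + lambda)^(k - N), a stationary
    supersolution, pays for the boundary value at N; for t < x the profile
    N (1 - a lambda)^k exp (a (1 + 2 a) lambda^2 s) dominates N - u.  With a
    small and fixed, both are O(N / (lambda N)) at the time and site of interest
    ([pr_large_le], [pr_small_le], [large_bound], [small_bound]).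

    The equation for the mean is not derived; it is compared with a discrete
    recursion instead, which avoids conditioning on the past of the process.
    Cut [0, T] into n steps of length h.  Up to an event of probability O(h)
    ([pr_not_good_le]) no site rings twice in a step and no two neighbours ring
    in the same step; then X on the grid is a function [replay] of the history,
    the list of the sets of sites ringing in each step, and of the resampling
    variables ([replay_path]).  For a fixed history the resampling variables in
    use have deterministic and distinct indices, so that independence gives
    the mean of [replay] on the event of that history ([integral_replay]).
    Summing over histories, the independence of the clock increments turns this
    into a recursion in the number of steps ([mean_sum_bulk]), which
    exp (- h) (1 + h (1 - c)) <= exp (- c h) keeps below the supersolution with
    no error term ([mean_sum_le]).  Then h tends to 0 ([tail_bound]). *)

(** * Integrals determined by weighted laws *)

Section weighted_laws.
Context (R : realType).
Import HBNNSimple.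

Section one_weight.
Context (d : measure_display) (T : measurableType d)
  (mu : {measure set T -> \bar R}) (Th Y : T -> R).
Hypotheses (mTh : measurable_fun setT Th) (mY : measurable_fun setT Y)
  (Y0 : forall x, 0 <= Y x).

Lemma integral_nnsfun_weight (h : {nnsfun R >-> R}) :
  (\int[mu]_x (h (Th x) * Y x)%:E =
   \sum_(r \in range h) r%:E * \int[mu]_(x in Th @^-1` (h @^-1` [set r])) (Y x)%:E)%E.
Proof.
have mA r : measurable (Th @^-1` (h @^-1` [set r])).
  by rewrite -[X in measurable X]setTI; exact: mTh.
transitivity (\int[mu]_x (\sum_(r \in range h)
    (r * \1_(Th @^-1` (h @^-1` [set r])) x * Y x)%:E))%E.
  apply: eq_integral => x _; rewrite (fimfunE h (Th x)).
  by rewrite mulr_fsuml fsumEFin.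
have r0 r x : 0 <= r * \1_(Th @^-1` (h @^-1` [set r])) x.
  rewrite indicE; have [|_] := boolP (x \in _); last by rewrite mulr0.
  by rewrite inE/= => <-; rewrite mulr1.
rewrite ge0_integral_fsum//; last 2 first.
- move=> r; apply/measurable_EFinP; apply: measurable_funM => //.
  by apply: measurable_funM => //; exact: measurable_indic.
- by move=> r x _; rewrite lee_fin mulr_ge0.
apply: eq_fsbigr => r; rewrite inE/= => -[y _ <-].
under eq_integral do rewrite -mulrA EFinM.
rewrite ge0_integralZl//; last 3 first.
- by apply/measurable_EFinP; apply: measurable_funM => //; exact: measurable_indic.
- by move=> x _; rewrite lee_fin mulr_ge0// indicE.
- by rewrite lee_fin.
congr (_ * _)%E; rewrite [RHS]integral_mkcond.
apply: eq_integral => x _; rewrite restrict_EFin/= patchE indicE.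
by case: (x \in _); rewrite ?mul1r ?mul0r.
Qed.

Lemma cvg_integral_nnsfun_weight (f : R -> R) (f0 : forall x, 0 <= f x)
    (mf : measurable_fun setT (EFin \o f)) :
  (\int[mu]_x (nnsfun_approx measurableT mf n (Th x) * Y x)%:E
     @[n --> \oo] --> \int[mu]_x (f (Th x) * Y x)%:E)%E.
Proof.
set h := nnsfun_approx measurableT mf.
have -> : (\int[mu]_x (f (Th x) * Y x)%:E =
    \int[mu]_x limn (fun n => (h n (Th x) * Y x)%:E))%E.
  apply: eq_integral => x _; apply/esym/cvg_lim => //.
  under eq_fun do rewrite EFinM.
  rewrite EFinM; apply: cvgeZr => //.
  apply: (@cvg_nnsfun_approx _ _ _ setT measurableT _ mf) => // y _.
  by rewrite /= lee_fin.
apply: cvg_monotone_convergence => //.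
- move=> n; apply/measurable_EFinP; apply: measurable_funM => //.
  exact: measurableT_comp.
- by move=> n x _; rewrite lee_fin mulr_ge0.
- move=> x _ m n mn; rewrite lee_fin ler_wpM2r//.
  by have /lefP := @nd_nnsfun_approx _ _ _ setT measurableT _ mf m n mn; exact.
Qed.

End one_weight.

(** The law of [Th1] weighted by [Y1] and that of [Th2] weighted by [Y2] are only
    compared on events; simple functions and monotone convergence carry the
    comparison over to integrals.  It serves both to pass from a density to
    expectations and to factor an expectation by independence. *)
Lemma eq_integral_weight (d1 d2 : measure_display)
    (T1 : measurableType d1) (T2 : measurableType d2)
    (mu1 : {measure set T1 -> \bar R}) (mu2 : {measure set T2 -> \bar R})
    (Th1 Y1 : T1 -> R) (Th2 Y2 : T2 -> R) (c : R) (f : R -> R) :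
  measurable_fun setT Th1 -> measurable_fun setT Y1 -> (forall x, 0 <= Y1 x) ->
  measurable_fun setT Th2 -> measurable_fun setT Y2 -> (forall x, 0 <= Y2 x) ->
  (forall B : set R, measurable B ->
    \int[mu1]_(x in Th1 @^-1` B) (Y1 x)%:E =
    c%:E * \int[mu2]_(x in Th2 @^-1` B) (Y2 x)%:E)%E ->
  measurable_fun setT f -> (forall x, 0 <= f x) ->
  (\int[mu1]_x (f (Th1 x) * Y1 x)%:E =
   c%:E * \int[mu2]_x (f (Th2 x) * Y2 x)%:E)%E.
Proof.
move=> mTh1 mY1 Y10 mTh2 mY2 Y20 E12 /measurable_EFinP mf f0.
have /cvg_lim <- // := @cvg_integral_nnsfun_weight _ T1 mu1 _ _ mTh1 mY1 Y10 f f0 mf.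
have H2 := @cvg_integral_nnsfun_weight _ T2 mu2 _ _ mTh2 mY2 Y20 f f0 mf.
apply/cvg_lim => //.
have E (h : {nnsfun R >-> R}) : (\int[mu1]_x (h (Th1 x) * Y1 x)%:E =
    c%:E * \int[mu2]_x (h (Th2 x) * Y2 x)%:E)%E.
  rewrite !integral_nnsfun_weight// ge0_mule_fsumr; last first.
    move=> r; have [[z hz]|] := pselect (exists z, h (Th2 z) = r).
      rewrite mule_ge0//; first by rewrite -hz lee_fin.
      by apply: integral_ge0 => x _; rewrite lee_fin.
    move=> hr; rewrite (_ : Th2 @^-1` _ = set0) ?integral_set0 ?mule0//.
    by apply/seteqP; split=> // z hz; apply: hr; exists z.
  by apply: eq_fsbigr => r _; rewrite E12 1?muleCA.
by under eq_fun do rewrite E; exact: cvgeZl.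
Qed.

End weighted_laws.

(** * Moments of Beta laws *)

Section beta_moments.
Context (R : realType).
Implicit Types a b c e x : R.
Local Notation leb := (@lebesgue_measure R).

Lemma continuous_powR c x : 0 < x -> {for x, continuous (@powR R ^~ c)}.
Proof.
move=> x0; apply: differentiable_continuous; apply/derivable1_diffP.
by apply: derivable_powR; rewrite in_itv/= x0.
Qed.

Lemma powR_cvg_right0 c : 0 <= c -> x `^ c @[x --> 0^'+] --> (0 : R) `^ c.
Proof.
rewrite le_eqVlt => /predU1P[<-|c0].
  by rewrite powRr0; under eq_fun do rewrite powRr0; exact: cvg_cst.
by rewrite powR0 ?gt_eqF//; exact: powR_cvg0.
Qed.

Lemma onem_cvg_left1 : (fun x : R => 1 - x) @ 1^'- --> (0 : R)^'+.
Proof.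
move=> A [e /= e0 HA]; exists e => //= x xe x1; apply: HA => /=.
  by move: xe; rewrite /= sub0r opprB ltr_norml => /andP[? ?]; rewrite ltr_norml; lra.
by rewrite subr_gt0.
Qed.

Lemma continuous_onem_powR e x : x < 1 ->
  {for x, continuous (fun y : R => (1 - y) `^ e)}.
Proof.
move=> x1; apply: (@continuous_comp _ _ _ (fun y : R => 1 - y) (@powR R ^~ e)).
  by apply: cvgB; [exact: cvg_cst|exact: cvg_id].
by apply: continuous_powR; rewrite subr_gt0.
Qed.

Lemma beta_monomial_within c e : 0 <= c -> 0 <= e ->
  {within `[0, 1], continuous (fun x : R => x `^ c * (1 - x) `^ e)}.
Proof.
move=> c0 e0; apply/continuous_within_itvP => //; split.
- move=> x; rewrite in_itv/= => /andP[x0 x1]; apply: cvgM.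
    exact: continuous_powR.
  exact: continuous_onem_powR.
- apply: cvgM; first exact: powR_cvg_right0.
  by apply: cvg_at_right_filter; exact: continuous_onem_powR.
- apply: cvgM.
    by apply: cvg_at_left_filter; exact: continuous_powR.
  rewrite subrr.
  apply: (@cvg_comp _ _ _ (fun x : R => 1 - x) (@powR R ^~ e) _ _ _ onem_cvg_left1).
  exact: powR_cvg_right0.
Qed.

Lemma beta_monomial_integrable c e : 0 <= c -> 0 <= e ->
  leb.-integrable `[0, 1]%classic
    (EFin \o (fun x : R => x `^ c * (1 - x) `^ e)).
Proof.
move=> c0 e0; apply: continuous_compact_integrable; first exact: segment_compact.
exact: beta_monomial_within.
Qed.

(** The derivative of x^a (1 - x)^b integrates to 0 over [0, 1].  As a and b are
    at least 1, the integrand is continuous up to the endpoints. *)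
Lemma beta_weight_recurrence a b : 1 <= a -> 1 <= b ->
  (a%:E * \int[leb]_(x in `[0%R, 1%R]) (x `^ (a - 1) * (1 - x) `^ b)%:E =
   b%:E * \int[leb]_(x in `[0%R, 1%R]) (x `^ a * (1 - x) `^ (b - 1))%:E)%E.
Proof.
move=> a1 b1.
have a0 : 0 <= a by lra.
have b0 : 0 <= b by lra.
have a10 : 0 <= a - 1 by lra.
have b10 : 0 <= b - 1 by lra.
have I1 := beta_monomial_integrable a10 b0.
have I2 := beta_monomial_integrable a0 b10.
set F := fun x : R => x `^ a * (1 - x) `^ b.
set f := fun x : R => a * (x `^ (a - 1) * (1 - x) `^ b) -
  b * (x `^ a * (1 - x) `^ (b - 1)).
have dF x : x \in `]0, 1[ -> is_derive x 1 F (f x).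
  rewrite in_itv/= => /andP[x0 x1].
  have D1 : is_derive x 1 (@powR R ^~ a) (a * x `^ (a - 1)).
    exact: is_derive1_powR.
  have D2 : is_derive x 1 (fun y : R => (1 - y) `^ b) (- (b * (1 - x) `^ (b - 1))).
    have x10 : 0 < 1 - x by rewrite subr_gt0.
    have D3 : is_derive (1 - x) 1 (@powR R ^~ b) (b * (1 - x) `^ (b - 1)).
      exact: is_derive1_powR.
    have D4 : is_derive x 1 (fun y : R => 1 - y) (- 1).
      have -> : (-1 : R) = 0 - 1 by rewrite sub0r.
      exact: is_deriveB.
    have := @is_derive1_comp _ (@powR R ^~ b) (fun y : R => 1 - y) x _ _ D3 D4.
    by rewrite mulrN1.
  have := is_deriveM D1 D2; rewrite /GRing.scale/= /f => H.
  by apply: is_derive_eq H _; ring.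
have /continuous_within_itvP [//|_ Fr Fl] := beta_monomial_within a0 b0.
have FTC : (\int[leb]_(x in `[0%R, 1%R]) (f x)%:E = (F 1)%:E - (F 0)%:E)%E.
  apply: continuous_FTC2 => //.
  - move=> x; apply: cvgB; apply: cvgM; [exact: cvg_cst| |exact: cvg_cst|].
      exact: beta_monomial_within.
    exact: beta_monomial_within.
  - by split=> // x x01; have [] := dF _ x01.
  - by move=> x x01; rewrite derive1E; have [] := dF _ x01.
have aN0 : a != 0 by rewrite gt_eqF//; lra.
have bN0 : b != 0 by rewrite gt_eqF//; lra.
have F10 : F 1 = 0 by rewrite /F subrr (powR0 bN0) mulr0.
have F00 : F 0 = 0 by rewrite /F (powR0 aN0) mul0r.
move: FTC; rewrite F10 F00 sube0; clear F F10 F00 Fr Fl dF.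
have -> : (\int[leb]_(x in `[0%R, 1%R]) (f x)%:E =
    \int[leb]_(x in `[0%R, 1%R]) (a%:E * (x `^ (a - 1) * (1 - x) `^ b)%:E -
      b%:E * (x `^ a * (1 - x) `^ (b - 1))%:E))%E.
  by apply: eq_integral => x _; rewrite /f EFinB 2!EFinM.
rewrite integralB; last 3 first.
- exact: measurable_itv.
- exact: (@integrableZl _ _ _ _ _ _ a _ I1).
- exact: (@integrableZl _ _ _ _ _ _ b _ I2).
rewrite (@integralZl _ _ _ leb _ (measurable_itv _) _ I1).
rewrite (@integralZl _ _ _ leb _ (measurable_itv _) _ I2).
have J1 := @integrable_fin_num _ _ _ leb _ (measurable_itv _) _ I1.
have J2 := @integrable_fin_num _ _ _ leb _ (measurable_itv _) _ I2.
move=> /eqP; rewrite sube_eq ?add0e.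
- by move/eqP.
- by rewrite fin_numM// J1.
- by rewrite fin_num_adde_defl// fin_numM// J2.
Qed.

End beta_moments.

Section beta_mean.
Context (R : realType).
Implicit Types a b x : R.
Local Notation leb := (@lebesgue_measure R).

(** Resampling variables lie in [0, 1] only almost surely; truncating them makes
    the bounds on the discretised process hold everywhere. *)
Definition clip x : R := Num.max 0 (Num.min 1 x).

Lemma clip_ge0 x : 0 <= clip x.
Proof. by rewrite /clip le_max lexx. Qed.

Lemma clip_le1 x : clip x <= 1.
Proof. by rewrite /clip ge_max ler01 ge_min lexx. Qed.

Lemma clip_id x : 0 <= x <= 1 -> clip x = x.
Proof. by move=> /andP[x0 x1]; rewrite /clip min_r// max_r. Qed.

Lemma measurable_clip : measurable_fun setT clip.
Proof. by apply: measurable_maxr => //; exact: measurable_minr. Qed.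

Lemma beta_densityE a b x : beta_density a b x =
  \1_(`]0, 1[%classic) x *
  ((\int[leb]_(y in `]0, 1[) beta_weight a b y)^-1 * beta_weight a b x).
Proof.
rewrite /beta_density indicE; have [x01|x01] := boolP (0 < x < 1).
  by rewrite mem_set ?mul1r 1?mulrC//= in_itv.
by rewrite memNset ?mul0r//= in_itv; exact/negP.
Qed.

Lemma beta_weight_ge0 a b x : 0 <= beta_weight a b x.
Proof. by rewrite mulr_ge0 ?powR_ge0. Qed.

Lemma measurable_beta_weight a b : measurable_fun setT (beta_weight a b).
Proof.
apply: measurable_funM; first exact: measurable_powR.
apply: (@measurableT_comp _ _ _ _ _ _ (@powR R ^~ (b - 1))).
  exact: measurable_powR.
exact: measurable_funB.
Qed.

Lemma beta_density_ge0 a b x : 0 <= beta_density a b x.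
Proof.
rewrite beta_densityE; apply: mulr_ge0; first by rewrite indicE.
apply: mulr_ge0; last exact: beta_weight_ge0.
rewrite invr_ge0.
by apply: Rintegral_ge0 => y _; exact: beta_weight_ge0.
Qed.

Lemma measurable_beta_density a b : measurable_fun setT (beta_density a b).
Proof.
rewrite (funext (beta_densityE a b)); apply: measurable_funM.
  exact: measurable_indic.
by apply: measurable_funM => //; exact: measurable_beta_weight.
Qed.

Lemma integral_beta_density a b (f g : R -> R) :
  measurable_fun setT f -> measurable_fun setT g ->
  (forall x, x \in `]0, 1[ -> f x * beta_weight a b x = g x) ->
  (forall x, 0 <= g x) ->
  (\int[leb]_x (f x * beta_density a b x)%:E =
   ((\int[leb]_(y in `]0, 1[) beta_weight a b y)^-1)%:E *
   \int[leb]_(x in `[0%R, 1%R]) (g x)%:E)%E.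
Proof.
move=> mf mg fg g0; set K := (Rintegral _ _ _).
rewrite integral_itv_bndoo; last first.
  by apply/measurable_EFinP; exact: measurable_funTS.
rewrite -ge0_integralZl//; last 3 first.
- by apply/measurable_EFinP; exact: measurable_funTS.
- by move=> x _; rewrite lee_fin.
- rewrite lee_fin invr_ge0.
  by apply: Rintegral_ge0 => y _; exact: beta_weight_ge0.
rewrite [RHS]integral_mkcond; apply: eq_integral => x _.
rewrite beta_densityE patchE indicE; case: ifPn => [|_]; last by rewrite mul0r mulr0.
by rewrite inE/= => x01; rewrite -EFinM mul1r mulrCA fg.
Qed.

Lemma mulr_powR_pred x a : 0 < x -> x * x `^ (a - 1) = x `^ a.
Proof.
move=> x0; rewrite -{1}(powRr1 (ltW x0)) -powRD ?(gt_eqF x0) ?implybT//.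
by rewrite addrC subrK.
Qed.

(** The two moments add up to the mass of the law, which is 1, and their ratio is
    a / b by [beta_weight_recurrence]; the normalising integral needs no
    separate treatment. *)
Lemma has_beta_law_moments (d : measure_display) (Om : measurableType d)
    (P : probability Om R) a b (Y : {RV P >-> R}) :
  1 <= a -> 1 <= b -> has_beta_law a b Y ->
  (\int[leb]_x (clip x * beta_density a b x)%:E = (a / (a + b))%:E)%E /\
  (\int[leb]_x ((1 - clip x) * beta_density a b x)%:E = (b / (a + b))%:E)%E.
Proof.
move=> a1 b1 /(_ setT measurableT) H.
have {H} one : (\int[leb]_x (clip x * beta_density a b x)%:E +
    \int[leb]_x ((1 - clip x) * beta_density a b x)%:E = 1)%E.
  transitivity (distribution P Y setT); last exact: probability_setT.
  rewrite H -ge0_integralD//; last 4 first.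
  - by move=> x _; rewrite lee_fin mulr_ge0 ?clip_ge0 ?beta_density_ge0.
  - apply/measurable_EFinP; apply: measurable_funM; first exact: measurable_clip.
    exact: measurable_beta_density.
  - by move=> x _; rewrite lee_fin mulr_ge0 ?subr_ge0 ?clip_le1 ?beta_density_ge0.
  - apply/measurable_EFinP; apply: measurable_funM; last exact: measurable_beta_density.
    by apply: measurable_funB => //; exact: measurable_clip.
  by apply: eq_integral => x _; rewrite -EFinD -mulrDl subrKC mul1r.
have rec : (b%:E * \int[leb]_x (clip x * beta_density a b x)%:E =
    a%:E * \int[leb]_x ((1 - clip x) * beta_density a b x)%:E)%E.
  rewrite (@integral_beta_density _ _ _ (fun x => x `^ a * (1 - x) `^ (b - 1))).
  - rewrite (@integral_beta_density _ _ (fun x => 1 - clip x)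
      (fun x => x `^ (a - 1) * (1 - x) `^ b)).
    + by rewrite muleCA -beta_weight_recurrence// muleCA.
    + by apply: measurable_funB => //; exact: measurable_clip.
    + have := measurable_beta_weight a (b + 1); rewrite /beta_weight.
      by under eq_fun do rewrite addrK.
    + move=> x; rewrite in_itv/= => /andP[x0 x1].
      rewrite clip_id ?(ltW x0) ?(ltW x1)// /beta_weight mulrCA; congr (_ * _).
      by rewrite mulr_powR_pred// subr_gt0.
    + by move=> x; rewrite mulr_ge0 ?powR_ge0.
  - exact: measurable_clip.
  - have := measurable_beta_weight (a + 1) b; rewrite /beta_weight.
    by under eq_fun do rewrite addrK.
  - move=> x; rewrite in_itv/= => /andP[x0 x1].
    rewrite clip_id ?(ltW x0) ?(ltW x1)// /beta_weight mulrA; congr (_ * _).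
    exact: mulr_powR_pred.
  - by move=> x; rewrite mulr_ge0 ?powR_ge0.
have u0 : (0 <= \int[leb]_x (clip x * beta_density a b x)%:E)%E.
  by apply: integral_ge0 => x _; rewrite lee_fin mulr_ge0 ?clip_ge0 ?beta_density_ge0.
have v0 : (0 <= \int[leb]_x ((1 - clip x) * beta_density a b x)%:E)%E.
  apply: integral_ge0 => x _.
  by rewrite lee_fin mulr_ge0 ?subr_ge0 ?clip_le1 ?beta_density_ge0.
move: one rec u0 v0; move: (integral _ _ _) => u; move: (integral _ _ _) => v.
move: u v => [u| |] [v| |]//=; rewrite -?EFinD -?EFinM => -[uv] [bu] _ _.
have ab : a + b != 0 by rewrite gt_eqF//; lra.
have -> : v = 1 - u by rewrite -uv addrC addKr.
have -> : u = a / (a + b).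
  apply: (mulIf ab); rewrite mulfVK// mulrDr (mulrC u b) bu mulrC -mulrDr.
  by rewrite uv mulr1.
by split => //; congr EFin; field.
Qed.

End beta_mean.

Section means_of_alpha.
Context (R : realType).
Implicit Types (lam : R) (k : nat).

Lemma alpha_ge1 a1 lam k : 1 <= a1 -> 0 < lam < 1 -> 1 <= alpha a1 lam k.
Proof.
move=> a11 /andP[l0 l1]; apply: mulr_ege1 => //; apply: exprn_ege1.
by rewrite ler_pdivlMr; lra.
Qed.

Lemma alpha_succ a1 lam k : (0 < k)%N ->
  alpha a1 lam k.+1 = alpha a1 lam k * ((1 + lam) / (1 - lam)).
Proof. by case: k => // k _; rewrite /alpha/= exprSr mulrA. Qed.

(** The ratio of consecutive parameters is (1 + lam) / (1 - lam) at every site,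
    hence the drift of the mean is the same everywhere. *)
Lemma alpha_mean a1 lam k : 1 <= a1 -> 0 < lam < 1 -> (0 < k)%N ->
  alpha a1 lam k / (alpha a1 lam k + alpha a1 lam k.+1) = (1 - lam) / 2 /\
  alpha a1 lam k.+1 / (alpha a1 lam k + alpha a1 lam k.+1) = (1 + lam) / 2.
Proof.
move=> a11 l01 k0; have := alpha_ge1 k a11 l01; rewrite alpha_succ//.
move: (alpha _ _ _) => c c1; move: l01 => /andP[l0 l1].
have c0 : c != 0 by rewrite gt_eqF//; lra.
have l10 : 1 - lam != 0 by rewrite gt_eqF//; lra.
have e : c * (1 - lam) + c * (1 + lam) != 0.
  by rewrite (_ : _ + _ = c * 2) ?mulf_neq0//; ring.
by split; field; rewrite l10 e.
Qed.

End means_of_alpha.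

(** * Independence of the sources of randomness *)

Section independence.
Context (R : realType) (d : measure_display) (Om : measurableType d)
  (P : probability Om R) (I : eqType).
Implicit Types (J : seq I) (E : I -> set Om).

Lemma bigcap_seqU1 (i0 : I) (A : set Om) J E : i0 \notin J ->
  \bigcap_(i in [set` i0 :: J]) (if i == i0 then A else E i) =
  \bigcap_(i in [set` J]) E i `&` A.
Proof.
move=> i0J; apply/seteqP; split=> w /= H.
  split; last by have := H i0; rewrite /= inE eqxx; exact.
  move=> i /= iJ; have := H i; rewrite /= inE iJ orbT => /(_ isT).
  by case: eqP => // ii0; move: i0J; rewrite -ii0 iJ.
move=> i /=; rewrite inE; case: eqP => [->|_] //=; first by case: H.
by case: H => + _; exact.
Qed.

Lemma mutually_independentU1 (D : set I) (F : I -> set (set Om))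
    (i0 : I) (A : set Om) J E :
  mutually_independent P D F -> uniq J ->
  (forall i, i \in J -> D i /\ F i (E i)) ->
  i0 \notin J -> D i0 -> F i0 A ->
  P (\bigcap_(i in [set` J]) E i `&` A) =
  (P (\bigcap_(i in [set` J]) E i) * P A)%E.
Proof.
move=> ind uJ JE i0J Di0 i0A; rewrite -(bigcap_seqU1 _ _ i0J).
rewrite (ind J E uJ JE) ind/=.
- rewrite big_cons eqxx muleC; congr (_ * _)%E.
  rewrite big_seq [RHS]big_seq; apply: eq_bigr => i iJ.
  by case: eqP => // ii0; move: i0J; rewrite -ii0 iJ.
- by rewrite i0J.
- move=> i; rewrite inE; case: eqP => [-> _//|_ /= iJ]; exact: JE.
Qed.

End independence.

Section generated_measurable.
Context (R : realType) (d d' : measure_display) (Om : measurableType d)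
  (P : probability Om R) (T : measurableType d').

Lemma generated_events_measurable (Y : {RV P >-> T}) A :
  generated_events Y A -> measurable A.
Proof.
move=> [C mC <-]; rewrite setTI.
by rewrite -[X in measurable X]setTI; exact: measurable_funPT.
Qed.

Lemma process_events_measurable (Y : R -> {RV P >-> T}) A :
  process_events Y A -> measurable A.
Proof.
apply: (@smallest_sub _ (sigma_algebra setT)) => //.
  exact: sigma_algebra_measurable.
by move=> B [t /= t0]; exact: generated_events_measurable.
Qed.

End generated_measurable.

(** * Replaying a history *)

Section replay.
Context (R : realType) (N : nat).
Implicit Types (g : 'I_N.+1 -> nat -> R) (z : 'I_N.+1 -> R)
  (B : {set 'I_N.+1}) (b : seq {set 'I_N.+1}) (k : 'I_N.+1).

Definition legal B : bool := [forall k in B, 0 < k < N]%N.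

Definition ring_count b k : nat := count (fun B => k \in B) b.

(** The head of a history is its most recent step.  [g k n] is the weight used at
    the n-th ring of site k: with the sampled weights this is the configuration
    reached, with all weights replaced by their mean it is its mean. *)
Fixpoint replay g z b k : R :=
  if b is B :: b' then
    if k \in B then
      (1 - g k (ring_count b' k).+1) * replay g z b' (inord k.-1)
      + g k (ring_count b' k).+1 * replay g z b' (inord k.+1)
    else replay g z b' k
  else z k.

Lemma replay_itv g z b (M : R) : (forall k n, 0 <= g k n <= 1) ->
  (forall k, 0 <= z k <= M) -> forall k, 0 <= replay g z b k <= M.
Proof.
move=> g01 zM; elim: b => //= B b IH k; case: ifPn => // _.
have /andP[g0 g1] := g01 k (ring_count b k).+1.
have /andP[x0 xM] := IH (inord k.-1); have /andP[y0 yM] := IH (inord k.+1).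
apply/andP; split; first by rewrite addr_ge0// mulr_ge0// subr_ge0.
by nra.
Qed.

Lemma replay_ge0 g z b k : (forall k n, 0 <= g k n <= 1) ->
  (forall k, 0 <= z k) -> 0 <= replay g z b k.
Proof.
move=> g01 z0; elim: b k => //= B b IH k; case: ifPn => // _.
have /andP[g0 g1] := g01 k (ring_count b k).+1.
by rewrite addr_ge0// mulr_ge0// subr_ge0.
Qed.

(** The updates are affine combinations, so N - X evolves by the same rule as X. *)
Lemma replay_compl g z b (M : R) k :
  replay g (fun i => M - z i) b k = M - replay g z b k.
Proof.
by elim: b k => //= B b IH k; case: ifPn => // _; rewrite !IH; ring.
Qed.

End replay.

Section replay_mean.
Context (R : realType) (d : measure_display) (Om : measurableType d)
  (P : probability Om R) (N : nat) (alpha1 lam : R)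
  (clock : 'I_N.+1 -> R -> {RV P >-> nat})
  (Theta : 'I_N.+1 -> nat -> {RV P >-> R}).
Hypotheses (alpha1_ge1 : 1 <= alpha1) (lam01 : 0 < lam < 1)
  (noise : driving_noise alpha1 lam clock Theta).

Definition source : Type := ('I_N.+1 + 'I_N.+1 * nat)%type.

Definition active (i : source) : Prop :=
  match i with inl k => bulk k | inr (k, _) => bulk k end.

Definition source_events (i : source) : set (set Om) :=
  match i with
  | inl k => process_events (clock k)
  | inr (k, n) => generated_events (Theta k n)
  end.

Definition weight (w : Om) (k : 'I_N.+1) (n : nat) : R := clip (Theta k n w).

Lemma weight01 w k n : 0 <= weight w k n <= 1.
Proof. by rewrite clip_ge0 clip_le1. Qed.

Lemma source_events_measurable i A : source_events i A -> measurable A.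
Proof.
case: i => [k|[k n]] /=; first exact: process_events_measurable.
exact: generated_events_measurable.
Qed.

Lemma measurable_weight k n : measurable_fun setT (fun w => weight w k n).
Proof.
apply: (@measurableT_comp _ _ _ _ _ _ (@clip R)); first exact: measurable_clip.
exact: measurable_funPT.
Qed.

Lemma measurable_replay z b k : measurable_fun setT (fun w => replay (weight w) z b k).
Proof.
elim: b k => [k|B b IH k] /=; first exact: measurable_cst.
case: (k \in B) => //; apply: measurable_funD; apply: measurable_funM => //.
  by apply: measurable_funB => //; exact: measurable_weight.
exact: measurable_weight.
Qed.

Definition mean_weight (k : 'I_N.+1) (n : nat) : R := (1 - lam) / 2.

(** The events [E i], [i] in [J], involve no resampling variable that [replay]
    consumes along [b]: their indices exceed the numbers of rings in [b]. *)
Definition fresh_family (b : seq {set 'I_N.+1}) (J : seq source)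
    (E : source -> set Om) : Prop :=
  [/\ uniq J, forall i, i \in J -> active i /\ source_events i (E i)
    & forall k n, inr (k, n) \in J -> (ring_count b k < n)%N].

Local Notation cap J E := (\bigcap_(i in [set` J]) E i).

Lemma measurable_cap (J : seq source) E :
  (forall i, i \in J -> active i /\ source_events i (E i)) ->
  measurable (cap J E).
Proof.
move=> JE; apply: fin_bigcap_measurable; first exact: finite_seq.
by move=> i /= /JE [_ /source_events_measurable].
Qed.

Lemma prob_capU1 (i0 : source) (A : set Om) J E : uniq J ->
  (forall i, i \in J -> active i /\ source_events i (E i)) ->
  i0 \notin J -> active i0 -> source_events i0 A ->
  P (cap J E `&` A) = (P (cap J E) * P A)%E.
Proof.
move=> uJ JE i0J ai0 i0A.
exact: (mutually_independentU1 (noise_independent noise) uJ JE i0J ai0 i0A).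
Qed.

(** If the part of [X] on [A] behaves on every event of [Theta k n] as if it were
    independent of it, then [f (Theta k n)] can be averaged out. *)
Lemma integral_fresh_weight k n (A : set Om) (X : Om -> R) (m : R) (f : R -> R) (mu : R) :
  bulk k -> measurable A -> measurable_fun setT X -> (forall w, 0 <= X w) ->
  (forall C : set R, measurable C ->
    \int[P]_(w in A `&` Theta k n @^-1` C) (X w)%:E =
    P A * P (Theta k n @^-1` C) * m%:E)%E ->
  measurable_fun setT f -> (forall x, 0 <= f x) ->
  (\int[@lebesgue_measure R]_x
     (f x * beta_density (alpha alpha1 lam k) (alpha alpha1 lam k.+1) x)%:E = mu%:E)%E ->
  (\int[P]_(w in A) (f (Theta k n w) * X w)%:E = P A * (mu * m)%:E)%E.
Proof.
move=> bk mA mX X0 H mf f0 fmu.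
have PA : (P A = (fine (P A))%:E)%E by rewrite fineK// fin_num_measure.
rewrite integral_mkcond.
transitivity (\int[P]_w (f (Theta k n w) * (\1_A w * X w))%:E)%E.
  apply: eq_integral => w _; rewrite patchE indicE.
  by case: (w \in A); rewrite ?mul1r ?mul0r ?mulr0.
rewrite (@eq_integral_weight _ _ _ _ _ P (@lebesgue_measure R) (Theta k n)
  (fun w => \1_A w * X w) id
  (beta_density (alpha alpha1 lam k) (alpha alpha1 lam k.+1)) (fine (P A) * m) f) //.
- by rewrite fmu PA -!EFinM mulrAC mulrA.
- by apply: measurable_funM => //; exact: measurable_indic.
- by move=> w; rewrite mulr_ge0// indicE.
- exact: measurable_beta_density.
- exact: beta_density_ge0.
- move=> C mC; rewrite preimage_id -(noise_Theta noise n bk mC).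
  rewrite EFinM -PA -muleA (muleC m%:E) muleA -H//.
  rewrite integral_mkcondl; apply: eq_integral => w _; rewrite patchE indicE.
  by case: (w \in A); rewrite ?mul1r ?mul0r.
Qed.

(** The induction hypothesis is used for the family enlarged by an event
    [Theta k n @^-1` C]: the variable consumed by the newest ring is fresh for
    the older part of the history, so that the weighted law of [Theta k n] is a
    multiple of its Beta law. *)
Lemma integral_replay (z : 'I_N.+1 -> R) b J E : (forall k, 0 <= z k) ->
  all (@legal N) b ->
  fresh_family b J E -> forall k,
  (\int[P]_(w in cap J E) (replay (weight w) z b k)%:E =
   P (cap J E) * (replay mean_weight z b k)%:E)%E.
Proof.
move=> z0; elim: b J E => [|B b IH] J E.
  move=> _ [_ JE _] k /=; rewrite integral_cst; last exact: measurable_cap.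
  by rewrite muleC.
move=> /= /andP[/forallP vB vb] [uJ JE fJ] k.
have [kB|kB] := boolP (k \in B); last first.
  apply: IH => //; split=> // l n /fJ /=; exact: leq_ltn_trans (leq_addl _ _).
have bk : bulk k by have := vB k; rewrite kB.
set n := (ring_count b k).+1.
have nJ : inr (k, n) \notin J.
  by apply/negP => /fJ /=; rewrite kB add1n ltnn.
have IHC l (C : set R) : measurable C ->
    (\int[P]_(w in cap J E `&` Theta k n @^-1` C) (replay (weight w) z b l)%:E =
    P (cap J E) * P (Theta k n @^-1` C) * (replay mean_weight z b l)%:E)%E.
  move=> mC; have gC : source_events (inr (k, n)) (Theta k n @^-1` C).
    by exists C => //; rewrite setTI.
  rewrite -(prob_capU1 uJ JE nJ bk gC) -(bigcap_seqU1 _ _ nJ); apply: IH => //; split.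
  - by rewrite /= nJ.
  - by move=> i; rewrite inE; case: eqP => [-> _//|_ /= iJ]; exact: JE.
  - move=> k' n'; rewrite inE => /orP[/eqP[-> ->]//|/fJ /=].
    exact: leq_ltn_trans (leq_addl _ _).
have [m1 m2] := has_beta_law_moments (alpha_ge1 k alpha1_ge1 lam01)
  (alpha_ge1 k.+1 alpha1_ge1 lam01) (noise_Theta noise n bk).
have k0 : (0 < k)%N by case/andP: bk.
have [e1 e2] := alpha_mean alpha1_ge1 lam01 k0.
rewrite e1 in m1; rewrite e2 in m2.
have mA := measurable_cap JE.
have X0 l w : 0 <= replay (weight w) z b l by apply: replay_ge0 => //; exact: weight01.
have I1 := integral_fresh_weight bk mA (measurable_replay z b _) (X0 _)
  (IHC (inord k.+1)) (@measurable_clip R) (@clip_ge0 R) m1.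
have mclip' : measurable_fun setT (fun x : R => 1 - clip x).
  by apply: measurable_funB => //; exact: measurable_clip.
have clip'0 x : 0 <= 1 - clip x :> R by rewrite subr_ge0 clip_le1.
have I2 := integral_fresh_weight bk mA (measurable_replay z b _) (X0 _)
  (IHC (inord k.-1)) mclip' clip'0 m2.
under eq_integral do rewrite EFinD.
rewrite ge0_integralD//; last 4 first.
- by move=> w _; rewrite lee_fin mulr_ge0 ?clip'0.
- apply/measurable_EFinP/measurable_funTS; apply: measurable_funM;
    last exact: measurable_replay.
  by apply: measurable_funB => //; exact: measurable_weight.
- by move=> w _; rewrite lee_fin mulr_ge0 ?clip_ge0.
- apply/measurable_EFinP/measurable_funTS; apply: measurable_funM;
    last exact: measurable_replay.
  exact: measurable_weight.
rewrite I1 I2 -muleDr ?fin_num_measure// -EFinD; congr (_ * _%:E)%E.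
by rewrite /mean_weight; congr (_ * _ + _); field.
Qed.

End replay_mean.

(** * Finite sums of probabilities *)

Section real_probability.
Context (R : realType) (d : measure_display) (Om : measurableType d)
  (P : probability Om R).
Implicit Types A B : set Om.

Definition pr A : R := fine (P A).

Lemma prE A : measurable A -> P A = (pr A)%:E.
Proof. by move=> mA; rewrite fineK// fin_num_measure. Qed.

Lemma pr_ge0 A : 0 <= pr A.
Proof. exact: fine_ge0. Qed.

Lemma pr_setT : pr setT = 1.
Proof. by rewrite /pr probability_setT. Qed.

Lemma pr_le A B : measurable A -> measurable B -> A `<=` B -> pr A <= pr B.
Proof.
by move=> mA mB AB; rewrite -lee_fin -!prE//; apply: le_measure; rewrite ?inE.
Qed.

Lemma pr_setDI A B : measurable A -> measurable B ->
  pr A = pr (A `&` B) + pr (A `\` B).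
Proof.
move=> mA mB; apply: EFin_inj; rewrite EFinD -!prE//.
- by rewrite addeC; exact: measureDI.
- exact: measurableD.
- exact: measurableI.
Qed.

Lemma sum_pr_le (I : eqType) (s : seq I) (F : I -> set Om) A : uniq s ->
  (forall i, i \in s -> measurable (F i)) -> measurable A ->
  (forall i, i \in s -> F i `<=` A) ->
  (forall i j, i \in s -> j \in s -> i != j -> F i `&` F j = set0) ->
  \sum_(i <- s) pr (F i) <= pr A.
Proof.
elim: s A => [|i s IH] A; first by rewrite big_nil pr_ge0.
move=> /= /andP[ins us] mF mA FA F0; rewrite big_cons.
have iIs : i \in i :: s by rewrite inE eqxx.
have mFi := mF _ iIs.
have sS j : j \in s -> j \in i :: s by rewrite inE orbC => ->.
rewrite (pr_setDI mA mFi) lerD//.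
  by rewrite (setIidr (FA _ iIs)).
apply: IH => //.
- by move=> j /sS; exact: mF.
- exact: measurableD.
- move=> j js w Fj; split; first exact: FA (sS _ js) _ Fj.
  move=> Fi; have : (F i `&` F j) w by [].
  by rewrite F0// ?sS//; apply: contraNneq ins => ->.
- by move=> j k js ks; apply: F0; exact: sS.
Qed.

Lemma pr_le_sum (I : eqType) (s : seq I) (F : I -> set Om) A :
  (forall i, i \in s -> measurable (F i)) -> measurable A ->
  (forall w, A w -> exists2 i, i \in s & F i w) ->
  pr A <= \sum_(i <- s) pr (F i).
Proof.
elim: s A => [|i s IH] A mF mA AF.
  rewrite big_nil (_ : A = set0) /pr ?measure0//.
  by apply/seteqP; split=> // w /AF[].
rewrite big_cons (pr_setDI mA (mF i _)) ?inE ?eqxx//; apply: lerD.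
  by apply: pr_le => //; [apply: measurableI => //|]; apply: mF; rewrite inE eqxx.
apply: IH.
- by move=> j js; apply: mF; rewrite inE js orbT.
- by apply: measurableD => //; apply: mF; rewrite inE eqxx.
- move=> w [/AF[j]]; rewrite inE => /orP[/eqP-> //|js Fj _].
  by exists j.
Qed.

End real_probability.

(** * Sums over histories *)

Section history_sums.
Context (R : realType) (N : nat).
Implicit Types (B : {set 'I_N.+1}) (b : seq {set 'I_N.+1}).

(** The sum of [f] over the legal histories of length [n].  The most recent step
    is summed first, which is the order in which recursions in time unfold. *)
Fixpoint hsum n (f : seq {set 'I_N.+1} -> R) : R :=
  if n is n'.+1 then hsum n' (fun b => \sum_(B | legal B) f (B :: b)) else f [::].

Lemma hsum_le n f g :
  (forall b, size b = n -> all (@legal N) b -> f b <= g b) -> hsum n f <= hsum n g.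
Proof.
elim: n f g => [|n IH] f g fg /=; first exact: fg.
apply: IH => b bn lb; apply: ler_sum => B lB; apply: fg => /=; first by rewrite bn.
by rewrite lB.
Qed.

Lemma hsumD n f g : hsum n (fun b => f b + g b) = hsum n f + hsum n g.
Proof.
elim: n f g => [//|n IH] f g /=; rewrite -IH; congr hsum; apply/funext => b.
by rewrite big_split.
Qed.

Lemma hsumZ n c f : hsum n (fun b => c * f b) = c * hsum n f.
Proof.
elim: n f => [//|n IH] f /=; rewrite -IH; congr hsum; apply/funext => b.
by rewrite mulr_sumr.
Qed.

End history_sums.

(** * Clock increments on a grid *)

Section clock_history.
Context (R : realType) (d : measure_display) (Om : measurableType d)
  (P : probability Om R) (N : nat) (alpha1 lam : R)
  (clock : 'I_N.+1 -> R -> {RV P >-> nat})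
  (Theta : 'I_N.+1 -> nat -> {RV P >-> R}).
Hypothesis noise : driving_noise alpha1 lam clock Theta.
Context (h : R) (h_gt0 : 0 < h).
Implicit Types (b : seq {set 'I_N.+1}) (k l : 'I_N.+1) (w : Om).

Definition ring_incr k (i : nat) w : nat :=
  (clock k (i.+1%:R * h) w - clock k (i%:R * h) w)%N.

Lemma grid_ge0 i : 0 <= i%:R * h.
Proof. by rewrite mulr_ge0// ltW. Qed.

Lemma grid_le i : i%:R * h <= i.+1%:R * h.
Proof. by rewrite ler_pM2r// ler_nat. Qed.

Lemma ring_incr_event k i (U : set nat) :
  process_events (clock k) [set w | U (ring_incr k i w)].
Proof.
set G := \bigcup_(t in [set t : R | 0 <= t]) generated_events (clock k t).
have mC t (V : set nat) : 0 <= t ->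
    measurable ((clock k t @^-1` V) : set (g_sigma_algebraType G)).
  move=> t0; apply: sub_sigma_algebra; exists t => //.
  by exists V => //; rewrite setTI.
have -> : [set w | U (ring_incr k i w)] =
    \bigcup_(n in [set: nat]) (clock k (i%:R * h) @^-1` [set n] `&`
      clock k (i.+1%:R * h) @^-1` [set m | U (m - n)%N]).
  apply/seteqP; split=> w /=; first by exists (clock k (i%:R * h) w).
  by move=> [n _ [/= <-]].
suff : measurable (\bigcup_(n in [set: nat]) (clock k (i%:R * h) @^-1` [set n] `&`
      clock k (i.+1%:R * h) @^-1` [set m | U (m - n)%N]) : set (g_sigma_algebraType G)).
  by [].
apply: bigcupT_measurable => n.
by apply: measurableI; apply: mC; exact: grid_ge0.
Qed.

Lemma measurable_ring_incr k i (U : set nat) : measurable [set w | U (ring_incr k i w)].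
Proof.
exact: process_events_measurable (@ring_incr_event k i U).
Qed.

Lemma pr_ring_incr_eq k i e : bulk k ->
  pr P [set w | ring_incr k i w = e] = h ^+ e / e`!%:R * expR (- h).
Proof.
move=> bk; have pp := noise_clock noise bk.
have := poisson_increment_law pp (grid_ge0 i) (grid_le i) [set e].
rewrite /pr => -> ; rewrite -mulrBl -natrB// subSn// subnn !mul1r.
rewrite /poisson_prob h_gt0 esum_set1 ?lee_fin ?poisson_pmf_ge0//=.
by rewrite /poisson_pmf h_gt0.
Qed.

Lemma sum_pr_ring_incr_le k i c :
  \sum_(e <- iota 0 c.+1) pr P [set w | minn (ring_incr k i w) c = e] <= 1.
Proof.
rewrite -(pr_setT P); apply: sum_pr_le => //.
- exact: iota_uniq.
- by move=> e _; exact: (@measurable_ring_incr k i [set n | minn n c = e]).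
- move=> e f _ _ ef; apply/seteqP; split=> // w [/= E1 E2].
  by move: ef; rewrite -E1 -E2 eqxx.
Qed.

Lemma pr_ring_incr_ge1 k i : bulk k ->
  pr P [set w | (1 <= ring_incr k i w)%N] <= h.
Proof.
move=> bk; have := sum_pr_ring_incr_le k i 1.
rewrite /= !big_cons big_nil addr0.
rewrite (_ : [set w | minn _ _ = 0%N] = [set w | ring_incr k i w = 0%N]); last first.
  by apply/seteqP; split=> w /=; case: (ring_incr k i w) => // -[].
rewrite (_ : [set w | minn _ _ = 1%N] = [set w | (1 <= ring_incr k i w)%N]); last first.
  by apply/seteqP; split=> w /=; [case: (ring_incr k i w)|move/minn_idPr].
rewrite pr_ring_incr_eq// fact0 divr1 mul1r.
have := expR_ge1Dx (- h); lra.
Qed.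

(** The values 0 and 1 have total probability exp (- h) (1 + h) >= 1 - h^2. *)
Lemma pr_ring_incr_ge2 k i : bulk k ->
  pr P [set w | (2 <= ring_incr k i w)%N] <= h ^+ 2.
Proof.
move=> bk; have := sum_pr_ring_incr_le k i 2.
rewrite /= !big_cons big_nil addr0.
rewrite (_ : [set w | minn _ _ = 0%N] = [set w | ring_incr k i w = 0%N]); last first.
  by apply/seteqP; split=> w /=; case: (ring_incr k i w) => // -[|[]].
rewrite (_ : [set w | minn _ _ = 1%N] = [set w | ring_incr k i w = 1%N]); last first.
  by apply/seteqP; split=> w /=; case: (ring_incr k i w) => // -[|[]].
rewrite (_ : [set w | minn _ _ = 2%N] = [set w | (2 <= ring_incr k i w)%N]); last first.
  by apply/seteqP; split=> w /=; [case: (ring_incr k i w) => [|[]]|move/minn_idPr].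
rewrite !pr_ring_incr_eq// fact0 factS fact0 muln1 !divr1 expr1 mul1r.
have e1 : (1 - h) * (1 + h) <= expR (- h) * (1 + h).
  by rewrite ler_wpM2r ?expR_ge1Dx// addr_ge0// ltW.
move: e1; rewrite expr2; lra.
Qed.

Lemma pr_two_rings k l i : bulk k -> bulk l -> k != l ->
  pr P ([set w | (1 <= ring_incr k i w)%N] `&` [set w | (1 <= ring_incr l i w)%N])
    <= h ^+ 2.
Proof.
move=> bk bl kl.
have PM : P ([set w | (1 <= ring_incr k i w)%N] `&` [set w | (1 <= ring_incr l i w)%N]) =
    (P [set w | (1 <= ring_incr k i w)%N] * P [set w | (1 <= ring_incr l i w)%N])%E.
  have eJ : [set w | (1 <= ring_incr k i w)%N] =
      \bigcap_(j in [set` [:: inl k : source N]]) [set w | (1 <= ring_incr k i w)%N].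
    by rewrite set_cons1 bigcap_set1.
  rewrite {1 2}eJ; apply: (prob_capU1 noise (i0 := inl l)) => //.
  - move=> j; rewrite inE => /eqP -> /=; split => //.
    exact: (@ring_incr_event k i [set n | 1 <= n]%N).
  - by rewrite inE; apply: contra kl => /eqP [->].
  - exact: (@ring_incr_event l i [set n | 1 <= n]%N).
have mk j : measurable [set w | (1 <= ring_incr j i w)%N].
  exact: (@measurable_ring_incr j i [set n | 1 <= n]%N).
rewrite /pr PM !prE//= expr2; apply: ler_pM; rewrite ?pr_ge0//; exact: pr_ring_incr_ge1.
Qed.

(** Demanding exactly one ring where the history shows a ring, rather than at
    least one, keeps the indices of the resampling variables determined by the
    history. *)
Fixpoint site_history b k : set Om :=
  if b is B :: b' then
    site_history b' k `&` [set w | ring_incr k (size b') w = (k \in B)]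
  else setT.

Definition history b : set Om := [set w | forall k, bulk k -> site_history b k w].

Lemma process_eventsI k (A A' : set Om) : process_events (clock k) A ->
  process_events (clock k) A' -> process_events (clock k) (A `&` A').
Proof.
set G := \bigcup_(t in [set t : R | 0 <= t]) generated_events (clock k t).
exact: (@measurableI _ (g_sigma_algebraType G)).
Qed.

Lemma site_history_event b k : process_events (clock k) (site_history b k).
Proof.
elim: b => [|B b IH] /=.
  exact: (@measurableT _ (g_sigma_algebraType
    (\bigcup_(t in [set t : R | 0 <= t]) generated_events (clock k t)))).
apply: process_eventsI => //.
exact: (@ring_incr_event k (size b) [set n : nat | n = (k \in B) :> nat]).
Qed.

(** The increments in chronological order, the form in which their independence
    is available. *)
Lemma site_historyE b k : site_history b k =
  \bigcap_(i in [set` iota 0 (size b)])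
    [set w | ring_incr k i w = (k \in nth finset.set0 b (size b - i.+1))].
Proof.
have memi (n i : nat) : [set` iota 0 n] i = (i < n)%N :> Prop.
  by rewrite /= mem_iota.
elim: b => [|B b IH]; first by rewrite set_nil bigcap_set0.
rewrite [LHS]/= IH; apply/seteqP; split=> w.
  move=> [H1 H2] i; rewrite memi ltnS leq_eqVlt => /orP[/eqP-> |ib].
    by rewrite /= subnn.
  by have := H1 i; rewrite memi => /(_ ib); rewrite /= subSS -(subnSK ib).
move=> H; split; last first.
  by have := H (size b); rewrite memi => /(_ (ltnSn _)); rewrite /= subnn.
move=> i; rewrite memi => ib; have := H i; rewrite memi => /(_ (ltnW ib)).
by rewrite /= subSS -(subnSK ib).
Qed.

Lemma prob_site_historyU1 b k e : bulk k ->
  P (site_history b k `&` [set w | ring_incr k (size b) w = e]) =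
  (P (site_history b k) * P [set w | ring_incr k (size b) w = e])%E.
Proof.
move=> bk; have pp := noise_clock noise bk; rewrite site_historyE.
have tS j : (j%:R * h : R) <= j.+1%:R * h by exact: grid_le.
have ind := poisson_independent_increments pp (grid_ge0 0) tS.
apply: (mutually_independentU1 (i0 := size b) ind) => //.
- exact: iota_uniq.
- move=> i _; split => //.
  by exists [set n : nat | n = (k \in nth finset.set0 b (size b - i.+1))].
- by rewrite mem_iota add0n ltnn.
- by exists [set n | n = e].
Qed.

End clock_history.

(** * The mean recursion *)

Section mean_over_histories.
Context (R : realType) (d : measure_display) (Om : measurableType d)
  (P : probability Om R) (N : nat) (alpha1 lam : R)
  (clock : 'I_N.+1 -> R -> {RV P >-> nat})
  (Theta : 'I_N.+1 -> nat -> {RV P >-> R}).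
Hypotheses (alpha1_ge1 : 1 <= alpha1) (lam01 : 0 < lam < 1)
  (noise : driving_noise alpha1 lam clock Theta).
Context (h : R) (h_gt0 : 0 < h).
Implicit Types (b : seq {set 'I_N.+1}) (B C : {set 'I_N.+1}) (k l : 'I_N.+1)
  (w : Om) (Q : pred 'I_N.+1).

Local Notation history := (history clock h).
Local Notation site_history := (site_history clock h).
Local Notation ring_incr := (ring_incr clock h).

Definition sites (Q : pred 'I_N.+1) : seq (source N) :=
  [seq inl k | k <- enum [pred k : 'I_N.+1 | (0 < k < N)%N && Q k]].

Definition history_family b (i : source N) : set Om :=
  if i is inl k then site_history b k else setT.

Lemma sitesP Q (i : source N) :
  reflect (exists2 k, bulk k & Q k /\ i = inl k) (i \in sites Q).
Proof.
apply: (iffP mapP) => [[k]|[k bk [Qk ->]]].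
  by rewrite mem_enum inE => /andP[bk Qk] ->; exists k.
by exists k => //; rewrite mem_enum inE Qk andbT; exact: bk.
Qed.

Lemma sites_uniq Q : uniq (sites Q).
Proof. by rewrite map_inj_uniq ?enum_uniq// => x y []. Qed.

Lemma history_family_events b Q (i : source N) : i \in sites Q ->
  active i /\ source_events clock Theta i (history_family b i).
Proof.
by move=> /sitesP[k bk [_ ->]]; split => //; exact: site_history_event.
Qed.

Lemma cap_history_family b Q : \bigcap_(i in [set` sites Q]) history_family b i =
  [set w | forall k, bulk k -> Q k -> site_history b k w].
Proof.
apply/seteqP; split=> w /= H.
  by move=> k bk Qk; apply: (H (inl k)) => /=; apply/sitesP; exists k.
by move=> i /= /sitesP[k bk [Qk ->]]; exact: H.
Qed.

Lemma historyE b : history b = \bigcap_(i in [set` sites predT]) history_family b i.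
Proof.
rewrite cap_history_family; apply/seteqP; split=> w /= H k bk; last exact: H.
by move=> _; exact: H.
Qed.

Lemma measurable_history b : measurable (history b).
Proof.
rewrite historyE; apply: (measurable_cap (clock := clock) (Theta := Theta)) => i.
exact: history_family_events.
Qed.

Lemma integral_replay_history (z : 'I_N.+1 -> R) b k : (forall i, 0 <= z i) ->
  all (@legal N) b ->
  (\int[P]_(w in history b) (replay (weight Theta w) z b k)%:E =
   P (history b) * (replay (@mean_weight R N lam) z b k)%:E)%E.
Proof.
move=> z0 lb; rewrite historyE; apply: (integral_replay alpha1_ge1 lam01 noise) => //.
split; [exact: sites_uniq|move=> i; exact: history_family_events|].
by move=> l n /sitesP[? _ []].
Qed.

(** The clocks of the other sites factor out first; then the next increment of
    clock [k] is independent of its previous ones. *)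
Lemma pr_history_ring_incr b k e : bulk k ->
  pr P (history b `&` [set w | ring_incr k (size b) w = e]) =
  pr P (history b) * pr P [set w | ring_incr k (size b) w = e].
Proof.
move=> bk; set Q := predC1 k.
set A := \bigcap_(i in [set` sites Q]) history_family b i.
have AE (C : set Om) : history b `&` C = A `&` (site_history b k `&` C).
  rewrite /A cap_history_family setIA; congr (_ `&` _).
  apply/seteqP; split=> w /=.
    by move=> H; split; [move=> l bl _; exact: H|exact: H].
  by move=> [H1 H2] l bl; have [->//|lk] := eqVneq l k; exact: H1.
have kQ : inl k \notin sites Q.
  by apply/negP => /sitesP[l _ [/eqP lk [kl]]]; apply: lk.
have ind (C : set Om) : process_events (clock k) C -> P (A `&` C) = (P A * P C)%E.
  move=> kC; apply: (prob_capU1 noise (i0 := inl k)) => //.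
    exact: sites_uniq.
  by move=> i; exact: history_family_events.
have mE : process_events (clock k) [set w | ring_incr k (size b) w = e].
  exact: (@ring_incr_event _ _ _ _ _ clock _ h_gt0 k (size b) [set n : nat | n = e]).
rewrite /pr AE ind; last by apply: process_eventsI => //; exact: site_history_event.
rewrite (prob_site_historyU1 noise)// muleA -ind; last exact: site_history_event.
have -> : A `&` site_history b k = history b.
  by rewrite -(setIT (site_history b k)) -AE setIT.
rewrite (prE P (measurable_history b)) prE//=.
exact: process_events_measurable mE.
Qed.

Lemma history_disjoint b B C : legal B -> legal C -> B != C ->
  history (B :: b) `&` history (C :: b) = set0.
Proof.
move=> /forallP lB /forallP lC BC; apply/seteqP; split => // w [HB HC].
move: BC => /eqP; apply; apply/setP => l.
have [bl|nbl] := boolP (0 < l < N)%N; last first.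
  have := lB l; have := lC l; rewrite (negPf nbl) !implybF.
  by move=> /negPf -> /negPf ->.
have [_ /= E1] := HB l bl; have [_ /= E2] := HC l bl.
by move: E1; rewrite E2; case: (l \in B); case: (l \in C).
Qed.

(** One-step extensions of a history are disjoint, and those with a prescribed
    behaviour at site [k] lie in one event of the next increment there. *)
Lemma sum_pr_history_le b k (e : bool) : bulk k ->
  \sum_(B | legal B && ((k \in B) == e)) pr P (history (B :: b)) <=
  pr P (history b) * (h ^+ e / e`!%:R * expR (- h)).
Proof.
move=> bk; rewrite -(pr_ring_incr_eq noise h_gt0 (size b) e bk).
rewrite -pr_history_ring_incr// -big_filter; apply: sum_pr_le.
- by rewrite filter_uniq// index_enum_uniq.
- by move=> B _; exact: measurable_history.
- apply: measurableI; first exact: measurable_history.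
  exact: (measurable_ring_incr clock h_gt0 k (size b) [set n : nat | n = e]).
- move=> B; rewrite mem_filter => /andP[/andP[_ /eqP kB] _] w Hw; split.
    by move=> l bl; have [] := Hw l bl.
  by have [_ /= ->] := Hw k bk; rewrite kB.
- move=> B C; rewrite !mem_filter => /andP[/andP[lB _] _] /andP[/andP[lC _] _].
  exact: history_disjoint.
Qed.

Lemma mean_weight01 k (n : nat) : 0 <= @mean_weight R N lam k n <= 1.
Proof.
move: lam01 => /andP[l0 l1]; rewrite /mean_weight; apply/andP; split.
  by rewrite divr_ge0// subr_ge0 ltW.
by rewrite ler_pdivrMr//; lra.
Qed.

(** The mean of the discretised configuration after [n] steps, restricted to the
    event that no site rings twice in a step. *)
Definition mean_sum (z : 'I_N.+1 -> R) n k : R :=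
  hsum n (fun b => pr P (history b) * replay (@mean_weight R N lam) z b k).

Lemma mean_sum_bulk (z : 'I_N.+1 -> R) n k : (forall i, 0 <= z i) -> bulk k ->
  mean_sum z n.+1 k <= expR (- h) * (mean_sum z n k +
    h * ((1 + lam) / 2 * mean_sum z n (inord k.-1) +
         (1 - lam) / 2 * mean_sum z n (inord k.+1))).
Proof.
move=> z0 bk; rewrite /mean_sum /=.
rewrite -!hsumZ -hsumD -hsumZ -hsumD -hsumZ; apply: hsum_le => b _ lb.
set m := replay _ z b.
have m0 l : 0 <= m l by apply: replay_ge0 => // *; exact: mean_weight01.
rewrite (bigID (fun B => k \in B)) /=.
rewrite (eq_bigr (fun B => pr P (history (B :: b)) *
   ((1 + lam) / 2 * m (inord k.-1) + (1 - lam) / 2 * m (inord k.+1)))); last first.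
  move=> B /andP[_ ->]; congr (_ * (_ * _ + _)).
  by rewrite /mean_weight; field.
rewrite [X in _ + X](eq_bigr (fun B => pr P (history (B :: b)) * m k)); last first.
  by move=> B /andP[_ /negPf ->].
rewrite -!mulr_suml.
have H1 := @sum_pr_history_le b k true bk.
have H0 := @sum_pr_history_le b k false bk.
rewrite /= fact0 !divr1 ?expr1 ?expr0 in H1 H0.
rewrite (eq_bigl _ _ (fun B => congr1 (andb _) (eqb_id _))) in H1.
rewrite (eq_bigl _ _ (fun B => congr1 (andb _) (eqbF_neg _))) in H0.
set M := (1 + lam) / 2 * m (inord k.-1) + (1 - lam) / 2 * m (inord k.+1).
have M0 : 0 <= M.
  by move: lam01 => /andP[l0 l1]; rewrite addr_ge0// mulr_ge0 ?m0// divr_ge0//; lra.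
have := ler_wpM2r M0 H1; have := ler_wpM2r (m0 k) H0.
move=> /[swap] L1 L0; apply: le_trans (lerD L1 L0) _.
by rewrite le_eqVlt; apply/orP; left; apply/eqP; rewrite /M; field.
Qed.

Lemma mean_sum_boundary (z : 'I_N.+1 -> R) n k : (forall i, 0 <= z i) -> ~ bulk k ->
  mean_sum z n k <= z k.
Proof.
move=> z0 nbk; elim: n => [|n IH].
  rewrite /mean_sum /= (_ : history [::] = setT) ?pr_setT ?mul1r//.
  by apply/seteqP; split.
apply: le_trans IH; rewrite /mean_sum /=; apply: hsum_le => b _ lb.
rewrite (eq_bigr (fun B =>
    pr P (history (B :: b)) * replay (@mean_weight R N lam) z b k)); last first.
  move=> B /forallP lB; case: ifPn => // kB.
  by case: nbk; have := lB k; rewrite kB.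
rewrite -mulr_suml ler_wpM2r//; first by apply: replay_ge0 => // *; exact: mean_weight01.
rewrite -big_filter; apply: sum_pr_le.
- by rewrite filter_uniq// index_enum_uniq.
- by move=> B _; exact: measurable_history.
- exact: measurable_history.
- by move=> B _ w Hw l bl; have [] := Hw l bl.
- move=> B C; rewrite !mem_filter => /andP[lB _] /andP[lC _].
  exact: history_disjoint.
Qed.

(** Discrete comparison principle: all coefficients of [mean_sum_bulk] are
    nonnegative. *)
Lemma mean_sum_le (z : 'I_N.+1 -> R) (W : nat -> 'I_N.+1 -> R) :
  (forall i, 0 <= z i) -> (forall k, z k <= W 0%N k) ->
  (forall n k, ~ bulk k -> z k <= W n k) ->
  (forall n k, bulk k -> expR (- h) * (W n k +
     h * ((1 + lam) / 2 * W n (inord k.-1) + (1 - lam) / 2 * W n (inord k.+1)))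
     <= W n.+1 k) ->
  forall n k, mean_sum z n k <= W n k.
Proof.
move=> z0 zW bW WW; have /andP[l0 l1] := lam01; elim=> [|n IH] k.
  rewrite /mean_sum /= (_ : history [::] = setT) ?pr_setT ?mul1r//.
  by apply/seteqP; split.
have [bk|nbk] := pselect (bulk k); last first.
  by apply: le_trans (bW _ _ nbk); exact: mean_sum_boundary.
apply: le_trans (WW _ _ bk); apply: le_trans (mean_sum_bulk _ z0 bk) _.
rewrite ler_wpM2l ?expR_ge0// lerD// ler_wpM2l ?(ltW h_gt0)//.
by rewrite lerD// ler_wpM2l// divr_ge0//; lra.
Qed.

(** As sites ring at most once per step on [G], the events of the legal histories
    cover [G]. *)
Lemma pr_le_hsum n (G : set Om) : measurable G ->
  (forall w, G w -> forall k i, bulk k -> (i < n)%N -> (ring_incr k i w <= 1)%N) ->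
  pr P G <= hsum n (fun b => pr P (G `&` history b)).
Proof.
move=> mG; elim: n => [|n IH] Gle /=.
  rewrite (_ : history [::] = setT) ?setIT//.
  by apply/seteqP; split.
apply: le_trans (IH _) _; first by move=> w Gw k i bk ni; apply: Gle => //; exact: ltnW.
apply: hsum_le => b bn lb; rewrite -big_filter; apply: pr_le_sum.
- by move=> B _; apply: measurableI => //; exact: measurable_history.
- by apply: measurableI => //; exact: measurable_history.
- move=> w [Gw Hw].
  pose B : {set 'I_N.+1} :=
    [set k : 'I_N.+1 | (0 < k < N)%N && (ring_incr k n w == 1)%N]%SET.
  exists B.
    rewrite mem_filter mem_index_enum andbT; apply/forallP => k; apply/implyP.
    by rewrite inE => /andP[].
  split=> // k bk; split; first exact: Hw.
  rewrite /= bn inE [(0 < k < N)%N]bk /=.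
  by have := Gle w Gw k n bk (ltnSn n); case: (ring_incr k n w) => [|[]].
Qed.

Lemma markov_histories (z : 'I_N.+1 -> R) n k (G : set Om) (delta : R) :
  (forall i, 0 <= z i) -> measurable G -> 0 < delta ->
  (forall w, G w -> forall k i, bulk k -> (i < n)%N -> (ring_incr k i w <= 1)%N) ->
  (forall w b, G w -> history b w -> size b = n -> all (@legal N) b ->
     delta <= replay (weight Theta w) z b k) ->
  delta * pr P G <= mean_sum z n k.
Proof.
move=> z0 mG d0 Gle Gd.
apply: (@le_trans _ _ (delta * hsum n (fun b => pr P (G `&` history b)))).
  by rewrite ler_pM2l//; exact: pr_le_hsum.
rewrite -hsumZ; apply: hsum_le => b bn lb.
have mGb : measurable (G `&` history b).
  by apply: measurableI => //; exact: measurable_history.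
rewrite -lee_fin EFinM -prE// EFinM -prE; last exact: measurable_history.
rewrite -integral_replay_history// -integral_cst//.
have mr := measurable_replay Theta z b k.
apply: (@le_trans _ _
    (\int[P]_(w in G `&` history b) (replay (weight Theta w) z b k)%:E)%E).
  apply: ge0_le_integral => //.
  - by move=> w _; rewrite lee_fin ltW.
  - by apply/measurable_EFinP; exact: measurable_funTS.
  - by move=> w [Gw Hw]; rewrite lee_fin; exact: Gd.
apply: ge0_subset_integral => //.
- exact: measurable_history.
- by apply/measurable_EFinP; exact: measurable_funTS.
- by move=> w _; rewrite lee_fin; apply: replay_ge0 => //; exact: weight01.
Qed.

End mean_over_histories.

(** * The process on the grid *)

Section counting_paths.
Context (R : realType) (c : R -> nat).
Hypotheses (c_nd : forall s t : R, 0 <= s -> s <= t -> (c s <= c t)%N)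
  (c_rc : forall t : R, 0 <= t -> \forall s \near t^'+, c s = c t).

Lemma still_no_ring (s t : R) : 0 <= s -> c s = c t ->
  forall u, s < u -> u <= t -> ~ rings c u.
Proof.
move=> s0 st u su ut [_ /(_ s s0 su)]; rewrite st ltnNge => /negP; apply.
by apply: c_nd => //; exact: le_trans (ltW su).
Qed.

(** The ring time is the infimum of the times at which the path has reached its
    final value; right continuity makes it attained. *)
Lemma last_ring (s t : R) : 0 <= s -> s <= t -> (c s < c t)%N ->
  exists u, [/\ s < u, u <= t, c u = c t & rings c u].
Proof.
move=> s0 st cst; pose S := [set v : R | 0 <= v /\ c v = c t].
have St : S t by split => //; exact: le_trans st.
have lbs : lbound S s.
  move=> v [v0 vt]; rewrite leNgt; apply/negP => vs.
  have := c_nd v0 (ltW vs); rewrite vt leqNgt; exact/negP/negPn.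
have hS : has_inf S by split; [exists t|exists s].
set u := inf S.
have su : s <= u by apply: lb_le_inf => //; exists t.
have u0 : 0 <= u by exact: le_trans su.
have ut : u <= t by apply: ge_inf => //; exists s.
have cu : c u = c t.
  have [e /= e0 He] := c_rc u0.
  have [v [v0 vt] vu] := inf_adherent e0 hS.
  have : u <= v by apply: ge_inf => //; exists s.
  rewrite le_eqVlt => /predU1P[->//|uv]; rewrite -vt; apply/esym/He => //=.
  by rewrite ler0_norm ?subr_le0 1?ltW// opprB ltrBlDl.
have su' : s < u.
  rewrite lt_neqAle su andbT; apply/eqP => E.
  by move: cst; rewrite E cu ltnn.
exists u; split => //; split; first exact: le_lt_trans su'.
move=> v v0 vu; rewrite ltn_neqAle c_nd ?(ltW vu)// andbT cu.
apply/eqP => cv; move: vu; rewrite ltNge => /negP; apply.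
by apply: ge_inf => //; exists s.
Qed.

End counting_paths.

Lemma lim_left_still (R : realType) (f : R -> R) (s u : R) : s < u ->
  (forall v, s <= v -> v < u -> f v = f s) -> lim (f v @[v --> u^'-]) = f s.
Proof.
move=> su fs; apply: lim_near_cst => //.
near=> v; apply: fs; near: v; [exact: nbhs_left_ge|exact: nbhs_left_lt].
Unshelve. all: by end_near. Qed.

Section pathwise_replay.
Context (R : realType) (d : measure_display) (Om : measurableType d)
  (P : probability Om R) (N : nat) (alpha1 lam : R) (x : 'I_N.+1 -> R)
  (clock : 'I_N.+1 -> R -> {RV P >-> nat})
  (Theta : 'I_N.+1 -> nat -> {RV P >-> R})
  (X : R -> 'I_N.+1 -> {RV P >-> R}).
Hypothesis proc : resampling_process alpha1 lam x clock Theta X.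
Context (h : R) (h_gt0 : 0 < h).
Implicit Types (k : 'I_N.+1) (w : Om).

Local Notation ring_incr := (ring_incr clock h).

(** What can spoil the correspondence with [replay]: a double ring in step [i],
    rings at two neighbours in step [i], an [i]-th weight outside [0, 1].  The
    kind [c] makes all conflicts up to a given step one finite family. *)
Definition conflict k i (c : 'I_3) : set Om := [set w | bulk k /\
  match nat_of_ord c with
  | 0 => (2 <= ring_incr k i w)%N
  | 1 => bulk (inord k.+1 : 'I_N.+1) /\ ((1 <= ring_incr k i w)%N /\
         (1 <= ring_incr (inord k.+1) i w)%N)
  | _ => ~ (0 <= Theta k i w <= 1)
  end].

Definition good n : set Om := [set w | forall k (i : 'I_n.+1) c, ~ conflict k i c w].

Let clocks k (bk : bulk k) := noise_clock (process_noise proc) bk.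

Lemma path_still k i w s : ~ (bulk k /\ (1 <= ring_incr k i w)%N) ->
  i%:R * h <= s -> s <= i.+1%:R * h -> X s k w = X (i%:R * h) k w.
Proof.
move=> H is_ si; have i0 := grid_ge0 h_gt0 i.
have [bk|nbk] := pselect (bulk k); last first.
  rewrite (process_boundary proc w (le_trans i0 is_) nbk).
  by rewrite (process_boundary proc w i0 nbk).
have pp := clocks bk.
apply: (process_still proc) => // u iu us.
apply: (@still_no_ring _ _ _ (i%:R * h) s) => //.
  by move=> ? ?; exact: (poisson_nondecreasing pp w).
apply/eqP; rewrite eqn_leq (poisson_nondecreasing pp)//=.
have : (ring_incr k i w < 1)%N by rewrite ltnNge; apply/negP => ?; apply: H.
rewrite ltnS leqn0 subn_eq0; apply: leq_trans.
by apply: (poisson_nondecreasing pp) => //; exact: le_trans is_.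
Qed.

(** The neighbours stand still during the step, so their values just before the
    ring are those at the beginning of the step. *)
Lemma path_ring k i w : bulk k -> ring_incr k i w = 1%N ->
  ~ (bulk (inord k.-1 : 'I_N.+1) /\ (1 <= ring_incr (inord k.-1) i w)%N) ->
  ~ (bulk (inord k.+1 : 'I_N.+1) /\ (1 <= ring_incr (inord k.+1) i w)%N) ->
  let theta := Theta k (clock k (i%:R * h) w).+1 w in
  X (i.+1%:R * h) k w = (1 - theta) * X (i%:R * h) (inord k.-1) w +
    theta * X (i%:R * h) (inord k.+1) w.
Proof.
move=> bk k1 H1 H2; have i0 := grid_ge0 h_gt0 i; have ii := grid_le h_gt0 i.
have pp := clocks bk.
have nd (s t : R) : 0 <= s -> s <= t -> (clock k s w <= clock k t w)%N.
  exact: (poisson_nondecreasing pp w).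
have ck : clock k (i.+1%:R * h) w = (clock k (i%:R * h) w).+1.
  by rewrite -(subnK (nd _ _ i0 ii)) [(_ - _)%N]k1.
have [] := @last_ring _ (clock k ^~ w) nd _ (i%:R * h) (i.+1%:R * h) i0 ii.
- by move=> t t0; exact: (poisson_right_continuous pp w t0).
- by rewrite ck.
move=> u [iu ui cu ru] /=.
have u0 : 0 <= u by exact: le_trans (ltW iu).
have -> : X (i.+1%:R * h) k w = X u k w.
  apply: (process_still proc) => // v uv vi.
  exact: (@still_no_ring _ _ nd u (i.+1%:R * h)).
rewrite (process_update proc bk ru) cu ck.
rewrite (@lim_left_still _ (fun s => X s (inord k.-1) w) (i%:R * h))//; last first.
  by move=> v iv vu; apply: path_still => //; exact: le_trans (ltW vu) ui.
rewrite (@lim_left_still _ (fun s => X s (inord k.+1) w) (i%:R * h))//.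
by move=> v iv vu; apply: path_still => //; exact: le_trans (ltW vu) ui.
Qed.

Lemma clock_history w b k : bulk k -> history clock h b w ->
  clock k ((size b)%:R * h) w = ring_count b k.
Proof.
move=> bk; elim: b => [_|B b IH] /=.
  by rewrite mul0r; exact: (poisson_start (clocks bk)).
move=> H; rewrite -(IH _); last by move=> l bl; have [] := H l bl.
have [_ /= kB] := H k bk.
have nd := poisson_nondecreasing (clocks bk) w (grid_ge0 h_gt0 (size b))
  (grid_le h_gt0 (size b)).
by rewrite -(subnK nd); congr (_ + _)%N.
Qed.

(** Simultaneous rings at sites at distance at least 2 do not interact, which is
    why a history may ring several sites in one step. *)
Lemma replay_path w n b : good n w -> (size b <= n)%N -> all (@legal N) b ->
  history clock h b w ->
  forall k, X ((size b)%:R * h) k w = replay (weight Theta w) x b k.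
Proof.
move=> gw; elim: b => [_ _ _ k|B b IH] /=.
  by rewrite mul0r (process_start proc).
move=> bn /andP[lB lb] H k.
have Hb : history clock h b w by move=> l bl; have [] := H l bl.
have {}IH := IH (ltnW bn) lb Hb.
have bn1 : (size b < n.+1)%N by exact: ltnW.
have incE l : bulk l -> ring_incr l (size b) w = (l \in B).
  by move=> bl; have [_] := H l bl.
have [kB|kB] := boolP (k \in B); last first.
  rewrite -IH; apply: path_still => //; last exact: grid_le.
  by move=> [bk]; rewrite incE// (negPf kB).
have bk : bulk k by have /forallP/(_ k) := lB; rewrite kB.
have /andP[k0 kN] := bk.
rewrite (path_ring bk); first last.
- move=> [bk1]; rewrite incE// => k1B; apply: (gw k (Ordinal bn1) (inord 1)); split => //.
  by rewrite inordK//=; split => //; rewrite !incE// kB.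
- move=> [bk1]; rewrite incE// => k1B.
  have e : inord (inord k.-1 : 'I_N.+1).+1 = k.
    rewrite inordK; last exact: leq_ltn_trans (leq_pred _) (ltn_ord k).
    by rewrite prednK// inord_val.
  apply: (gw (inord k.-1) (Ordinal bn1) (inord 1)); split => //.
  by rewrite inordK//= e; split => //; rewrite !incE// kB.
- by rewrite incE// kB.
rewrite (clock_history bk Hb) !IH /weight clip_id//.
have cn1 : ((ring_count b k).+1 < n.+1)%N.
  by rewrite ltnS; apply: leq_trans bn; rewrite ltnS count_size.
apply: contrapT => nTh; apply: (gw k (Ordinal cn1) (inord 2)); split => //.
by rewrite inordK.
Qed.

End pathwise_replay.

(** * Discretisation error and tail bounds *)

Section discretisation_error.
Context (R : realType) (d : measure_display) (Om : measurableType d)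
  (P : probability Om R) (N : nat) (alpha1 lam : R)
  (clock : 'I_N.+1 -> R -> {RV P >-> nat})
  (Theta : 'I_N.+1 -> nat -> {RV P >-> R}).
Hypothesis noise : driving_noise alpha1 lam clock Theta.
Context (h : R) (h_gt0 : 0 < h).
Implicit Types (k : 'I_N.+1) (w : Om).

Local Notation ring_incr := (ring_incr clock h).
Local Notation conflict := (conflict clock Theta h).
Local Notation good := (good clock Theta h).

Lemma pr_Theta_outside k n : bulk k -> pr P [set w | ~ (0 <= Theta k n w <= 1)] = 0.
Proof.
move=> bk; have mC : measurable (~` `[0, 1]%classic : set R).
  by apply: measurableC; exact: measurable_itv.
have -> : [set w | ~ (0 <= Theta k n w <= 1)] = Theta k n @^-1` (~` `[0, 1]%classic).
  by apply/seteqP; split => w /=; rewrite in_itv.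
rewrite /pr [P _](noise_Theta noise n bk mC) integral0_eq// => y /= y01.
rewrite /beta_density; case: ifPn => // /andP[y0 y1]; case: y01.
by rewrite in_itv/= (ltW y0) (ltW y1).
Qed.

Lemma measurable_conflict k i c : measurable (conflict k i c).
Proof.
have [bk|nbk] := pselect (bulk k); last first.
  by rewrite (_ : conflict _ _ _ = set0)//; apply/seteqP; split => // w [].
have mr l (j : nat) : measurable [set w | (j <= ring_incr l i w)%N].
  exact: (measurable_ring_incr clock h_gt0 l i [set n | j <= n]%N).
case: c => -[|[|[|//]]] cI.
- rewrite (_ : conflict _ _ _ = [set w | (2 <= ring_incr k i w)%N])//.
  by apply/seteqP; split => w; [case|split].
- have [bk1|nbk1] := pselect (bulk (inord k.+1 : 'I_N.+1)); last first.
    by rewrite (_ : conflict _ _ _ = set0)//; apply/seteqP; split => // w [_ []].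
  rewrite (_ : conflict _ _ _ = [set w | (1 <= ring_incr k i w)%N] `&`
      [set w | (1 <= ring_incr (inord k.+1) i w)%N]).
    exact: measurableI.
  by apply/seteqP; split => w; [case=> _ [_]|move=> ?; split].
- have -> : conflict k i (Ordinal cI) = Theta k i @^-1` (~` `[0, 1]%classic).
    by apply/seteqP; split => w /=; rewrite in_itv; [case|split].
  rewrite -[X in measurable X]setTI; apply: measurable_funPT => //.
  by apply: measurableC; exact: measurable_itv.
Qed.

Lemma pr_conflict_le k i c : pr P (conflict k i c) <= h ^+ 2.
Proof.
have [bk|nbk] := pselect (bulk k); last first.
  rewrite (_ : conflict _ _ _ = set0) ?/pr ?measure0 ?exprn_ge0 ?(ltW h_gt0)//.
  by apply/seteqP; split => // w [].
case: c => -[|[|[|//]]] cI.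
- rewrite (_ : conflict _ _ _ = [set w | (2 <= ring_incr k i w)%N]).
    exact: (pr_ring_incr_ge2 noise).
  by apply/seteqP; split => w; [case|split].
- have [bk1|nbk1] := pselect (bulk (inord k.+1 : 'I_N.+1)); last first.
    rewrite (_ : conflict _ _ _ = set0) ?/pr ?measure0 ?exprn_ge0 ?(ltW h_gt0)//.
    by apply/seteqP; split => // w [_ []].
  rewrite (_ : conflict _ _ _ = [set w | (1 <= ring_incr k i w)%N] `&`
      [set w | (1 <= ring_incr (inord k.+1) i w)%N]).
    apply: (pr_two_rings noise) => //; apply/eqP => /(congr1 val)/=.
    by rewrite inordK => [/esym/eqP|]; rewrite ?gtn_eqF//; case/andP: bk.
  by apply/seteqP; split => w; [case=> _ [_]|move=> ?; split].
- rewrite (_ : conflict _ _ _ = [set w | ~ (0 <= Theta k i w <= 1)]).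
    by rewrite pr_Theta_outside// exprn_ge0// ltW.
  by apply/seteqP; split => w; [case|split].
Qed.

Lemma good_compl n : ~` good n =
  \bigcup_(a in [set` index_enum ('I_N.+1 * 'I_n.+1 * 'I_3)%type])
    conflict a.1.1 a.1.2 a.2.
Proof.
apply/seteqP; split => w.
  move=> /existsNP[k] /existsNP[i] /existsNP[c] /contrapT H.
  by exists (k, i, c) => //=; rewrite mem_index_enum.
by move=> [[[k i] c] _ /= H] /(_ k i c).
Qed.

Lemma measurable_good n : measurable (good n).
Proof.
rewrite -[good n]setCK good_compl; apply: measurableC.
by apply: fin_bigcup_measurable => // a _; exact: measurable_conflict.
Qed.

(** The step length is squared while the number of steps is of order 1 / h. *)
Lemma pr_not_good_le n : pr P (~` good n) <= (N.+1 * n.+1 * 3)%:R * h ^+ 2.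
Proof.
have := @pr_le_sum _ _ _ P _ (index_enum ('I_N.+1 * 'I_n.+1 * 'I_3)%type)
  (fun a => conflict a.1.1 a.1.2 a.2) (~` good n).
move=> /(_ _ _ _)/le_trans; apply.
- by move=> a _; exact: measurable_conflict.
- by apply: measurableC; exact: measurable_good.
- by move=> w; rewrite good_compl => -[a aI aw]; exists a.
apply: (@le_trans _ _ (\sum_(a : 'I_N.+1 * 'I_n.+1 * 'I_3) h ^+ 2)).
  by apply: ler_sum => a _; exact: pr_conflict_le.
by rewrite sumr_const -[X in X <= _]mulr_natl !card_prod !card_ord.
Qed.

End discretisation_error.

Section tail_bound.
Context (R : realType) (d : measure_display) (Om : measurableType d)
  (P : probability Om R) (N : nat) (alpha1 lam : R)
  (clock : 'I_N.+1 -> R -> {RV P >-> nat})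
  (Theta : 'I_N.+1 -> nat -> {RV P >-> R}).
Hypotheses (alpha1_ge1 : 1 <= alpha1) (lam01 : 0 < lam < 1)
  (noise : driving_noise alpha1 lam clock Theta).

(** A supersolution of the equation of the means, in the time-discrete form used
    in [mean_sum_le]. *)
Definition supersolution (W : R -> nat -> R) : Prop :=
  forall s h k, 0 <= s -> 0 < h -> (0 < k < N)%N ->
    expR (- h) * (W s k + h * ((1 + lam) / 2 * W s k.-1 + (1 - lam) / 2 * W s k.+1))
      <= W (s + h) k.

(** A profile on which the jump operator contracts by 1 - c decays at rate c; the
    discretisation costs nothing since 1 + h (1 - c) <= exp (h (1 - c)). *)
Lemma supersolution_exp (g : nat -> R) (c : R) :
  (forall k, (0 < k < N)%N ->
    0 <= g k /\ (1 + lam) / 2 * g k.-1 + (1 - lam) / 2 * g k.+1 <= (1 - c) * g k) ->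
  supersolution (fun s k => expR (- (c * s)) * g k).
Proof.
move=> Hg s h k s0 h0 kN; have [gk {}Hg] := Hg k kN.
apply: (@le_trans _ _ (expR (- (c * s)) * (expR (- h) * ((1 + h * (1 - c)) * g k)))).
  rewrite (_ : _ * _ = expR (- (c * s)) * (expR (- h) * (g k + h *
    ((1 + lam) / 2 * g k.-1 + (1 - lam) / 2 * g k.+1)))); last by ring.
  rewrite ler_wpM2l ?expR_ge0// ler_wpM2l ?expR_ge0//.
  rewrite [(1 + h * _) * _]mulrDl mul1r lerD2l -[h * _ * _]mulrA ler_wpM2l//; exact: ltW.
rewrite [c * (s + h)]mulrDr opprD expRD -mulrA ler_wpM2l ?expR_ge0// mulrA ler_wpM2r//.
apply: (@le_trans _ _ (expR (- h) * expR (h * (1 - c)))).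
  by rewrite ler_wpM2l ?expR_ge0// expR_ge1Dx.
by rewrite -expRD le_eqVlt; apply/orP; left; apply/eqP; congr expR; ring.
Qed.

Lemma supersolutionD W1 W2 : supersolution W1 -> supersolution W2 ->
  supersolution (fun s k => W1 s k + W2 s k).
Proof.
move=> S1 S2 s h k s0 h0 kN.
apply: le_trans (lerD (S1 s h k s0 h0 kN) (S2 s h k s0 h0 kN)).
by rewrite le_eqVlt; apply/orP; left; apply/eqP; ring.
Qed.

(** Markov's inequality for [replay], up to the discretisation error, which
    vanishes as the number of steps grows with [T] and [N] fixed. *)
Lemma tail_bound (z : 'I_N.+1 -> R) (W : R -> nat -> R) (T delta : R) k (E : set Om) :
  0 < T -> 0 < delta -> measurable E ->
  (forall i, 0 <= z i) -> supersolution W ->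
  (forall i, z i <= W 0 i) ->
  (forall s i, 0 <= s -> ~ bulk i -> z i <= W s i) ->
  (forall h n w b, 0 < h -> n%:R * h = T -> E w -> good clock Theta h n w ->
     history clock h b w -> size b = n -> all (@legal N) b ->
     delta <= replay (weight Theta w) z b k) ->
  delta * pr P E <= W T k.
Proof.
move=> T0 d0 mE z0 SW z_W bW HE.
have step n : delta * pr P E <= W T k +
    delta * ((N.+1 * n.+2 * 3)%:R * (T / n.+1%:R) ^+ 2).
  set h := T / n.+1%:R.
  have h0 : 0 < h by rewrite divr_gt0.
  have nh : n.+1%:R * h = T by rewrite mulrC divfK.
  have mG := measurable_good clock Theta h0 n.+1.
  rewrite (pr_setDI P mE mG) mulrDr lerD//; last first.
    rewrite ler_pM2l//; apply: le_trans (pr_not_good_le noise h0 n.+1).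
    apply: pr_le; [exact: measurableD|exact: measurableC|by move=> w []].
  apply: (@le_trans _ _ (mean_sum lam clock h z n.+1 k)).
    apply: (markov_histories alpha1_ge1 lam01 noise h0) => //.
    - exact: measurableI.
    - move=> w [_ gw] l i bl ni; rewrite leqNgt; apply/negP => H.
      by apply: (gw l (Ordinal (ltnW ni : i < n.+2)%N) (inord 0)); split; rewrite ?inordK.
    - by move=> w b [Ew gw] Hw bn lb; exact: (HE h n.+1 w b).
  rewrite -nh.
  apply: (mean_sum_le lam01 noise h0 z0 (W := fun n l => W (n%:R * h) l)).
  - by move=> l; rewrite mul0r.
  - by move=> m l; apply: bW; exact: grid_ge0.
  - move=> m l bl; have /andP[l0 lN] := bl.
    rewrite [nat_of_ord (inord l.-1)]inordK; last first.
      exact: leq_ltn_trans (leq_pred _) (ltn_ord l).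
    rewrite [nat_of_ord (inord l.+1)]inordK//.
    rewrite (_ : m.+1%:R * h = m%:R * h + h); last by rewrite -natr1 mulrDl mul1r.
    by apply: SW => //; exact: grid_ge0.
apply/ler_addgt0Pr => e e0.
set C := delta * ((N.+1 * 2 * 3)%:R * T ^+ 2).
have C0 : 0 <= C by rewrite mulr_ge0 ?(ltW d0)// mulr_ge0// exprn_ge0// ltW.
have [n Hn] : exists n : nat, C / e < n.+1%:R.
  exists (Num.truncn (C / e)); exact: truncnS_gt.
apply: le_trans (step n) _; rewrite lerD2l.
apply: (@le_trans _ _ (C / n.+1%:R)); last first.
  rewrite ler_pdivrMr// mulrC -ler_pdivrMr//; exact: ltW.
rewrite /C -!mulrA ler_pM2l//.
have n2 : n.+2%:R <= 2 * n.+1%:R :> R by rewrite -natrM ler_nat; lia.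
have a0 : n.+1%:R != 0 :> R by rewrite pnatr_eq0.
rewrite !natrM -subr_ge0.
rewrite (_ : _ - _ = N.+1%:R * 3 * (T / n.+1%:R) ^+ 2 * (2 * n.+1%:R - n.+2%:R)).
  by rewrite mulr_ge0 ?subr_ge0// mulr_ge0 ?sqr_ge0// mulr_ge0.
by field.
Qed.

End tail_bound.

(** * Supersolutions for the maximal process *)

Section tails_of_the_maximal_process.
Context (R : realType) (d : measure_display) (Om : measurableType d)
  (P : probability Om R) (N : nat) (alpha1 lam : R)
  (clock : 'I_N.+1 -> R -> {RV P >-> nat})
  (Theta : 'I_N.+1 -> nat -> {RV P >-> R})
  (X : R -> 'I_N.+1 -> {RV P >-> R}).
Hypotheses (alpha1_ge1 : 1 <= alpha1) (lam01 : 0 < lam < 1) (N2 : (2 <= N)%N)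
  (proc : resampling_process alpha1 lam (@max_config R N) clock Theta X).
Implicit Types (k : 'I_N.+1) (a eps T l : R).

Let noise := process_noise proc.

Lemma measurable_deviation T k eps l :
  measurable [set w | eps <= `|N%:R^-1 * X T k w - l| ].
Proof.
have mf : measurable_fun setT (fun w => `|N%:R^-1 * X T k w - l|).
  apply: (@measurableT_comp _ _ _ _ _ _ (@Num.norm R R)); first exact: normr_measurable.
  by apply: measurable_funB => //; apply: measurable_funM => //; exact: measurable_funPT.
rewrite (_ : [set w | _] = (fun w => `|N%:R^-1 * X T k w - l|) @^-1` `[eps, +oo[%classic).
  by rewrite -[X in measurable X]setTI; exact: mf.
by apply/seteqP; split => w /=; rewrite in_itv/= andbT.
Qed.

Lemma max_config_itv k : 0 <= max_config R k <= N%:R.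
Proof. by rewrite /max_config; case: ifP => _; rewrite ?lexx ?ler0n. Qed.

(** The second profile is stationary up to the inequality
    1 - lam <= (1 + lam)^-1, and equals N at site N at all times, where the first
    one may have decayed below the boundary value. *)
Lemma pr_large_le a eps T k : 0 < a < 1 -> 0 < eps -> 0 < T ->
  eps * pr P [set w | eps <= `|N%:R^-1 * X T k w - 0| ] <=
  expR (- (a * lam ^+ 2 * (1 - a) * T)) * (1 + a * lam) ^+ k +
    ((1 + lam)^-1) ^+ (N - k).
Proof.
move=> /andP[a0 a1] e0 T0; have /andP[l0 l1] := lam01.
have N0 : 0 < N%:R :> R by rewrite ltr0n; lia.
have q0 : 0 <= 1 + a * lam by rewrite addr_ge0// mulr_ge0// ltW.
have p0 : 0 <= (1 + lam)^-1 by rewrite invr_ge0 addr_ge0// ltW.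
set c := a * lam ^+ 2 * (1 - a).
(* The rate 0 puts the stationary profile in the form of [supersolution_exp]. *)
pose W (s : R) (i : nat) := expR (- (c * s)) * (N%:R * (1 + a * lam) ^+ i) +
  expR (- (0 * s)) * (N%:R * ((1 + lam)^-1) ^+ (N - i)).
have SW : supersolution N lam W.
  apply: supersolutionD; apply: supersolution_exp => i /andP[i0 iN].
    split; first by rewrite mulr_ge0 ?exprn_ge0// ltW.
    rewrite -(prednK i0) /= !exprS; move: (_ ^+ _) (exprn_ge0 i.-1 q0) => q qi.
    rewrite -subr_ge0 /c.
    rewrite (_ : _ - _ = N%:R * q *
        (a * lam ^+ 2 / 2 * (a * (1 - lam) + 2 * a ^+ 2 * lam))).
      rewrite !mulr_ge0//= ?ltW// ?exprn_gt0//.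
      by rewrite addr_gt0 ?mulr_gt0 ?exprn_gt0// subr_gt0.
    by field.
  split; first by rewrite mulr_ge0 ?exprn_ge0// ltW.
  have -> : (N - i.-1 = (N - i.+1).+2)%N by lia.
  have -> : (N - i = (N - i.+1).+1)%N by lia.
  rewrite !exprS; move: (_ ^+ _) (exprn_ge0 (N - i.+1) p0) => q qi.
  have l1N : 1 + lam != 0 by rewrite gt_eqF// addr_gt0.
  rewrite -subr_ge0.
  rewrite (_ : _ - _ = N%:R * q * (lam ^+ 2 / 2 * (1 + lam)^-1)).
    by rewrite !mulr_ge0// ltW.
  by field.
have W1 (s : R) (i : nat) : 0 <= expR (- (c * s)) * (N%:R * (1 + a * lam) ^+ i).
  by rewrite mulr_ge0 ?expR_ge0// mulr_ge0 ?exprn_ge0// ltW.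
have W2 (s : R) (i : nat) : 0 <= expR (- (0 * s)) * (N%:R * ((1 + lam)^-1) ^+ (N - i)).
  by rewrite mulr_ge0 ?expR_ge0// mulr_ge0 ?exprn_ge0// ltW.
have WT : W T k = N%:R * (expR (- (c * T)) * (1 + a * lam) ^+ k +
    ((1 + lam)^-1) ^+ (N - k)).
  by rewrite /W mul0r oppr0 expR0; ring.
rewrite -(ler_pM2l N0) -WT mulrA.
apply: (tail_bound alpha1_ge1 lam01 noise (z := @max_config R N)) => //.
- exact: mulr_gt0.
- exact: measurable_deviation.
- by move=> i; have /andP[] := max_config_itv i.
- move=> i; apply: ler_wpDr => //; rewrite mulr0 oppr0 expR0 mul1r.
  apply: (@le_trans _ _ N%:R); first by have /andP[] := max_config_itv i.
  by rewrite ler_peMr ?(ltW N0)// exprn_ege1// lerDl mulr_ge0// ltW.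
- move=> s i s0 nbi; rewrite /W; have [->|i0] := eqVneq i ord0.
    by rewrite {1}/max_config eqxx addr_ge0.
  have -> : nat_of_ord i = N.
    have := ltn_ord i; rewrite ltnS leq_eqVlt => /orP[/eqP//|iN]; case: nbi.
    by rewrite /bulk iN andbT lt0n.
  apply: ler_wpDl => //; rewrite subnn expr0 mulr1 mul0r oppr0 expR0 mul1r.
  by have /andP[] := max_config_itv i.
- move=> h n w b h0 nh Ew gw Hw bn lb.
  have := replay_path proc h0 gw (eq_leq bn) lb Hw k.
  rewrite bn nh => E; move: Ew; rewrite /= E subr0 normrM ger0_norm ?invr_ge0 ?(ltW N0)//.
  rewrite ger0_norm; first by rewrite ler_pdivlMl.
  apply: replay_ge0; first by move=> *; exact: weight01.
  by move=> i; have /andP[] := max_config_itv i.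
Qed.

(** Here the process is N - X, which is N at site 0, where the profile starts
    from N and grows, and 0 at site N. *)
Lemma pr_small_le a eps T k : 0 < a <= 2^-1 -> 0 < eps -> 0 < T ->
  eps * pr P [set w | eps <= `|N%:R^-1 * X T k w - 1| ] <=
  expR (a * lam ^+ 2 * (1 + 2 * a) * T) * (1 - a * lam) ^+ k.
Proof.
move=> /andP[a0 a1] e0 T0; have /andP[l0 l1] := lam01.
have N0 : 0 < N%:R :> R by rewrite ltr0n; lia.
have al : a * lam <= 2^-1.
  by rewrite -[leRHS]mulr1; apply: ler_pM => //; exact: ltW.
have p0 : 0 <= 1 - a * lam by rewrite subr_ge0 (le_trans al)// invf_le1// ler1n.
set c := - (a * lam ^+ 2 * (1 + 2 * a)).
have c0 : c <= 0 by rewrite oppr_le0 !mulr_ge0// ?addr_ge0 ?mulr_ge0 ?exprn_ge0// ltW.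
pose W (s : R) (i : nat) := expR (- (c * s)) * (N%:R * (1 - a * lam) ^+ i).
have SW : supersolution N lam W.
  apply: supersolution_exp => i /andP[i0 iN].
  split; first by rewrite mulr_ge0 ?exprn_ge0// ltW.
  rewrite -(prednK i0) /= !exprS; move: (_ ^+ _) (exprn_ge0 i.-1 p0) => q qi.
  rewrite -subr_ge0 /c.
  rewrite (_ : _ - _ = N%:R * q * (a * lam ^+ 2 / 2 *
     (a * (1 - lam) + 2 * a * (1 - lam * (2 * a))))).
    apply: mulr_ge0; first by rewrite mulr_ge0// ltW.
    apply: mulr_ge0; first by rewrite !mulr_ge0// ltW// exprn_gt0.
    have b2 : 0 <= 1 - lam * (2 * a) by move: al; lra.
    by rewrite addr_ge0// mulr_ge0// ?subr_ge0 ?ltW// mulr_gt0.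
  by field.
have W1 (s : R) (i : nat) : 0 <= W s i.
  by rewrite mulr_ge0 ?expR_ge0// mulr_ge0 ?exprn_ge0// ltW.
have z_itv (i : 'I_N.+1) : 0 <= N%:R - max_config R i.
  by have /andP[] := max_config_itv i; rewrite subr_ge0.
have WT : W T k = N%:R * (expR (a * lam ^+ 2 * (1 + 2 * a) * T) * (1 - a * lam) ^+ k).
  by rewrite /W /c mulNr opprK; ring.
rewrite -(ler_pM2l N0) -WT mulrA.
apply: (tail_bound alpha1_ge1 lam01 noise (z := fun i => N%:R - @max_config R N i)) => //.
- exact: mulr_gt0.
- exact: measurable_deviation.
- move=> i; rewrite /max_config; case: eqVneq => [->|_]; last by rewrite subrr.
  by rewrite subr0 /W mulr0 oppr0 expR0 mul1r expr0 mulr1.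
- move=> s i s0 _; rewrite /max_config; case: eqVneq => [->|_]; last by rewrite subrr.
  rewrite /W expr0 mulr1 subr0 ler_peMl ?(ltW N0)// -[leLHS]expR0 ler_expR.
  by rewrite oppr_ge0 mulr_le0_ge0.
- move=> h n w b h0 nh Ew gw Hw bn lb.
  have := replay_path proc h0 gw (eq_leq bn) lb Hw k.
  rewrite bn nh => E; move: Ew; rewrite /= E replay_compl.
  have /andP[r0 rN] := replay_itv b (weight01 Theta w) max_config_itv k.
  rewrite distrC ger0_norm; last by rewrite subr_ge0 ler_pdivrMl// mulr1.
  by rewrite -(ler_pM2l N0) mulrBr mulr1 mulVKf// gt_eqF.
Qed.

End tails_of_the_maximal_process.

(** * The limit N -> oo *)

Section asymptotics.
Context (R : realType).
Implicit Types (a x t y : R).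

Lemma expRN_le_inv y : 0 < y -> expR (- y) <= y^-1.
Proof.
move=> y0; rewrite expRN lef_pV2 ?posrE ?expR_gt0//.
by apply: le_trans (expR_ge1Dx y); rewrite lerDr.
Qed.

Lemma exprn_le_expR y n : 0 <= 1 + y -> (1 + y) ^+ n <= expR (y * n%:R).
Proof.
by move=> y0; rewrite expRM_natr lerXn2r ?nnegrE ?expR_ge0 ?expR_ge1Dx.
Qed.

Lemma bernoulli_le_exprn y n : 0 <= y -> 1 + y * n%:R <= (1 + y) ^+ n.
Proof.
move=> y0; elim: n => [|n IH]; first by rewrite mulr0 addr0 expr0.
rewrite exprS; apply: (@le_trans _ _ ((1 + y) * (1 + y * n%:R))); last first.
  by rewrite ler_wpM2l// addr_ge0.
have : 0 <= y * (y * n%:R) by rewrite !mulr_ge0.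
by rewrite -natr1; lra.
Qed.

(** The exponent is at most - a lam N ((1 - a) t - x); the chosen [a] makes
    (1 - a) t the midpoint of x and t. *)
Lemma large_bound (N k : nat) (lam x t a : R) : 0 < lam < 1 -> (0 < N)%N ->
  (k%:R <= x * N%:R) -> x < 1 -> x < t -> a = (t - x) / (2 * t) -> 0 < x ->
  expR (- (a * lam ^+ 2 * (1 - a) * (N%:R * t / lam))) * (1 + a * lam) ^+ k +
    ((1 + lam)^-1) ^+ (N - k) <=
  (2 / (a * (t - x)) + (1 - x)^-1) * (N%:R^-1 / lam).
Proof.
move=> /andP[l0 l1] N0 kx x1 xt aE x0.
have t0 : 0 < t by exact: lt_trans xt.
have a0 : 0 < a by rewrite aE divr_gt0 ?subr_gt0// mulr_gt0.
have N0' : 0 < N%:R :> R by rewrite ltr0n.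
have kN : (k <= N)%N.
  by rewrite -(ler_nat R) (le_trans kx)// ler_piMl ?ltW.
rewrite mulrDl; apply: lerD.
  apply: (@le_trans _ _ (expR (- (a * lam * N%:R * (t - x) / 2)))).
    apply: (@le_trans _ _ (expR (- (a * lam ^+ 2 * (1 - a) * (N%:R * t / lam))) *
        expR (a * lam * k%:R))).
      apply: ler_wpM2l; first exact: expR_ge0.
      by apply: exprn_le_expR; rewrite addr_ge0// mulr_ge0// ltW.
    rewrite -expRD ler_expR.
    apply: (@le_trans _ _ (- (a * lam ^+ 2 * (1 - a) * (N%:R * t / lam)) +
        a * lam * (x * N%:R))).
      by rewrite lerD2l ler_pM2l// mulr_gt0.
    rewrite le_eqVlt; apply/orP; left; apply/eqP.
    rewrite aE; field; by rewrite !gt_eqF.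
  apply: le_trans (expRN_le_inv _) _.
    by rewrite divr_gt0// !mulr_gt0// subr_gt0.
  rewrite le_eqVlt; apply/orP; left; apply/eqP; field.
  by rewrite !gt_eqF// ?subr_gt0.
rewrite exprVn -!invfM lef_pV2 ?posrE ?exprn_gt0 ?mulr_gt0 ?subr_gt0 ?addr_gt0//.
have H : 1 + lam * (N - k)%:R <= (1 + lam) ^+ (N - k).
  by apply: bernoulli_le_exprn; exact: ltW.
apply: le_trans H; rewrite natrB//.
have H : 0 <= lam * (x * N%:R - k%:R) by rewrite mulr_ge0 ?subr_ge0// ltW.
lra.
Qed.

(** The exponent is at most a lam - a lam N (x - (1 + 2 a) t), the first term
    coming from the rounding of the site; the chosen [a] puts (1 + 2 a) t below
    the midpoint of t and x, as t < 1. *)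
Lemma small_bound (N k : nat) (lam x t a : R) : 0 < lam < 1 -> (0 < N)%N ->
  (x * N%:R < k.+1%:R) -> x < 1 -> t < x -> a = (x - t) / 4 -> 0 < t ->
  expR (a * lam ^+ 2 * (1 + 2 * a) * (N%:R * t / lam)) * (1 - a * lam) ^+ k <=
  (expR 1 * 2 / (a * (x - t))) * (N%:R^-1 / lam).
Proof.
move=> /andP[l0 l1] N0 kx x1 tx aE t0.
have a0 : 0 < a by rewrite aE divr_gt0 ?subr_gt0.
have N0' : 0 < N%:R :> R by rewrite ltr0n.
have a1 : a <= 1 by rewrite aE; lra.
have al1 : a * lam <= 1 by rewrite mulr_ile1// ltW.
have al0 : 0 < a * lam by rewrite mulr_gt0.
apply: (@le_trans _ _ (expR (1 - (a * lam * N%:R * (x - t) / 2)))).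
  apply: (@le_trans _ _ (expR (a * lam ^+ 2 * (1 + 2 * a) * (N%:R * t / lam)) *
      expR (- (a * lam) * k%:R))).
    apply: ler_wpM2l; first exact: expR_ge0.
    by apply: exprn_le_expR; rewrite subr_ge0.
  rewrite -expRD ler_expR.
  have H1 : a * lam * (x * N%:R) <= a * lam * (k%:R + 1).
    by rewrite ler_pM2l// natr1 ltW.
  have -> : a * lam ^+ 2 * (1 + 2 * a) * (N%:R * t / lam) =
      a * lam * N%:R * (t + 2 * a * t) by field; rewrite gt_eqF.
  have H3 : a * lam * N%:R * (t + 2 * a * t) <= a * lam * N%:R * ((x + t) / 2).
    rewrite ler_pM2l ?mulr_gt0// aE.
    have : (x - t) * t <= (x - t) * 1 by rewrite ler_pM2l ?subr_gt0//; lra.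
    lra.
  move: al1 H1 H3; rewrite -!mulrA; lra.
rewrite expRD -!mulrA ler_pM2l ?expR_gt0// !mulrA.
apply: le_trans (expRN_le_inv _) _.
  by rewrite divr_gt0// !mulr_gt0// subr_gt0.
rewrite le_eqVlt; apply/orP; left; apply/eqP; field.
by rewrite !gt_eqF// ?subr_gt0.
Qed.

Lemma cvg_prob_of_le (d : nat -> measure_display)
    (Om : forall N, measurableType (d N)) (P : forall N, probability (Om N) R)
    (E : forall N, set (Om N)) (v : nat -> R) (C : R) :
  v N @[N --> \oo] --> (0 : R) ->
  (forall N, (2 <= N)%N -> measurable (E N) /\ pr (P N) (E N) <= C * v N) ->
  P N (E N) @[N --> \oo] --> 0%E.
Proof.
move=> v0 H.
have Cv : C * v N @[N --> \oo] --> (0 : R) by rewrite -(mulr0 C); exact: cvgMl_tmp.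
have Cv' : (C * v N)%:E @[N --> \oo] --> 0%E by apply: cvg_EFin => //; exact: nearW.
apply: (squeeze_cvge _ (cvg_cst 0%E) Cv'); near=> N.
have [mE HE] : measurable (E N) /\ pr (P N) (E N) <= C * v N.
  by apply: H; near: N; exists 2%N.
by rewrite (prE _ mE) !lee_fin pr_ge0.
Unshelve. all: by end_near. Qed.

End asymptotics.

Theorem proposition2 (R : realType) (alpha1 : R) (lambda : nat -> R)
    (d : nat -> measure_display) (Om : forall N, measurableType (d N))
    (P : forall N, probability (Om N) R)
    (clock : forall N, 'I_N.+1 -> R -> {RV (P N) >-> nat})
    (Theta : forall N, 'I_N.+1 -> nat -> {RV (P N) >-> R})
    (Xmax : forall N, R -> 'I_N.+1 -> {RV (P N) >-> R}) :
  1 <= alpha1 ->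
  (forall N, (2 <= N)%N -> 0 < lambda N < 1) ->
  dominates lambda (fun N => N%:R^-1) ->
  (forall N, (2 <= N)%N ->
     resampling_process alpha1 (lambda N) (@max_config R N)
       (@clock N) (@Theta N) (@Xmax N)) ->
  forall x t : R, 0 < x < 1 -> 0 < t -> x != t ->
    cvg_in_probability P
      (fun N => rescaled_profile (lambda N) (@Xmax N) x t)
      (\1_(`[t, 1]%classic) x).
Proof.
move=> a1 l01 ldom proc x t /andP[x0 x1] t0 xt eps e0.
pose kk N : 'I_N.+1 := inord (Num.truncn (x * N%:R)).
have xN N : 0 <= x * N%:R by rewrite mulr_ge0// ltW.
have kE N : nat_of_ord (kk N) = Num.truncn (x * N%:R).
  rewrite /kk inordK// -(ltr_nat R).
  apply: le_lt_trans (_ : N%:R < _); last by rewrite ltr_nat.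
  have /andP[+ _] := truncn_itv (xN N); move=> /le_trans; apply.
  by rewrite ler_piMl// ltW.
have [xt'|tx] := ltP x t.
  have -> : \1_(`[t, 1]%classic) x = 0 :> R.
    by rewrite indicE memNset//= in_itv/= leNgt xt'.
  set a := (t - x) / (2 * t).
  have aa : 0 < a < 1.
    rewrite /a divr_gt0 ?subr_gt0 ?mulr_gt0//= ltr_pdivrMr ?mulr_gt0//; lra.
  apply: (cvg_prob_of_le (C := eps^-1 * (2 / (a * (t - x)) + (1 - x)^-1)) ldom) => N N2.
  split; first exact: measurable_deviation.
  have /andP[l0 l1] := l01 N N2.
  have N0 : (0 < N)%N by lia.
  have T0 : 0 < N%:R * t / lambda N by rewrite divr_gt0// mulr_gt0// ltr0n.
  have := pr_large_le a1 (l01 N N2) N2 (proc N N2) (kk N) aa e0 T0.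
  rewrite -[eps^-1 * _ * _]mulrA ler_pdivlMl// => /le_trans; apply.
  apply: large_bound => //; first exact: l01.
  by rewrite kE; have /andP[] := truncn_itv (xN N).
have {xt}tx : t < x by rewrite lt_neqAle eq_sym xt.
have -> : \1_(`[t, 1]%classic) x = 1 :> R.
  by rewrite indicE mem_set//= in_itv/= !ltW.
set a := (x - t) / 4.
have aa : 0 < a <= 2^-1.
  by rewrite /a divr_gt0 ?subr_gt0//=; lra.
apply: (cvg_prob_of_le (C := eps^-1 * (expR 1 * 2 / (a * (x - t)))) ldom) => N N2.
split; first exact: measurable_deviation.
have /andP[l0 l1] := l01 N N2.
have N0 : (0 < N)%N by lia.
have T0 : 0 < N%:R * t / lambda N by rewrite divr_gt0// mulr_gt0// ltr0n.
have := pr_small_le a1 (l01 N N2) N2 (proc N N2) (kk N) aa e0 T0.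
rewrite -[eps^-1 * _ * _]mulrA ler_pdivlMl// => /le_trans; apply.
apply: small_bound => //; first exact: l01.
by rewrite kE; have /andP[] := truncn_itv (xN N).
Qed.
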